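(* Consider the time-varying time-delay system $\dot x(t)=f(t,x_t,u(t))$, $t\in J$, described in the context. Let $V(t,\phi):J_\tau\times\mathbf{C}([-\tau,0],\mathbf{R}^n)\to J$ be a continuous functional, $\mu(t)$ a uniformly stable function, $\alpha_1,\alpha_2\in\mathcal{K}_\infty$, $\varpi\in\mathcal{K}_\infty$, and $\varpi_1,\varpi_2\in\mathcal{K}$. Consider the following conditions, where $t\in J$: (h1) $\alpha_1(|\phi(0)|)\le V(t,\phi)\le\alpha_2(\|\phi\|)$ for all $\phi\in\mathbf{C}([-\tau,0],\mathbf{R}^n)$. (h2) $\dot V(t,x_t)\le\mu(t)V(t,x_t)$ if $V(t,x_t)\ge\varpi(|u(t)|)$. (h3) $\dot V(t,x_t)\le(\varpi_1(|u(t)|)+\mu(t))V(t,x_t)+\varpi_2(|u(t)|)$. (h4) $\dot V(t,x_t)\le\mu(t)V(t,x_t)$. (D) There exist positive numbers $\beta_0,\beta_1,\beta_2$ such that $\alpha_1(s)=\beta_1s^{\beta_0}$, $\alpha_2(s)=\beta_2s^{\beta_0}$. Then the system is 1. ISS if (h1) and (h2) are satisfied; 2. iISS if (h1) and (h3) are satisfied; 3. GUAS if (h1) and (h4) are satisfied; 4. GUES if (h1), (h4) and (D) are satisfied.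
   Context: Notation. $J=[0,\infty)$, $\tau\ge0$, $J_\tau=[-\tau,\infty)$; $|\cdot|$ is the Euclidean norm; $\mathbf{C}([-\tau,0],\mathbf{R}^n)$ is the space of continuous functions with norm $\|\phi\|=\sup_{-\tau\le\theta\le0}|\phi(\theta)|$; $x_t(\theta)=x(t+\theta)$ for $\theta\in[-\tau,0]$; $\|u\|_{[t_0,t]}=\sup\{|u(s)|:s\in[t_0,t]\}$; $\mathbf{L}_\infty^l$ is the set of $u:J\to\mathbf{R}^l$ with $\sup_{t\in J}|u(t)|<\infty$. $\mathcal{K},\mathcal{K}_\infty,\mathcal{KL}$ are the usual comparison function classes. System. $f:J\times\mathbf{C}([-\tau,0],\mathbf{R}^n)\times\mathbf{R}^l\to\mathbf{R}^n$ is locally Lipschitz in $(t,x)$, uniformly continuous in $u$, and $f(t,0,0)=0$ for all $t\in J$; the initial condition at $t_0\in J$ is $x_{t_0}\in\mathbf{C}([-\tau,0],\mathbf{R}^n)$; the input $u:J\to\mathbf{R}^l$ is locally essentially bounded. Stability of the trivial solution (for any initial condition, all $t,t_0\in J$, $t\ge t_0$). ISS (input-to-state stable): there exist $\sigma\in\mathcal{KL}$, $\gamma_1\in\mathcal{K}$ such that for any $u\in\mathbf{L}_\infty^l$, $|x(t)|\le\sigma(\|x_{t_0}\|,t-t_0)+\gamma_1(\|u\|_{[t_0,t]})$. iISS (integral ISS): there exist $\sigma\in\mathcal{KL}$, $\gamma_1,\gamma_2\in\mathcal{K}$ such that for any $u$, $|x(t)|\le\sigma(\|x_{t_0}\|,t-t_0)+\gamma_1\big(\int_{t_0}^t\gamma_2(|u(s)|)\,\mathrm{d}s\big)$.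 GUAS (globally uniformly asymptotically stable): there is $\sigma\in\mathcal{KL}$ such that, when $u\equiv0$, $|x(t)|\le\sigma(\|x_{t_0}\|,t-t_0)$. GUES (globally uniformly exponentially stable): there are constants $\alpha>0,\beta>0$ such that, when $u\equiv0$, $|x(t)|\le\beta\mathrm{e}^{-\alpha(t-t_0)}\|x_{t_0}\|$. $\dot V(t,x_t)$ denotes the time-derivative of $t\mapsto V(t,x_t)$ along solutions of the system; conditions involving $x_t$ are required along the solutions (every initial time $t_0\in J$, initial condition and input $u$, with $u\equiv0$ in the case of GUAS and GUES; $t\ge t_0$). A continuous $\mu:J\to\mathbf{R}$ is a uniformly stable function (USF) if there are constants $\varepsilon>0$, $\delta\ge0$ with $\int_{t_0}^t\mu(s)\,\mathrm{d}s\le-\varepsilon(t-t_0)+\delta$ for all $t\ge t_0$ in $J$ (equivalently $\dot y=\mu(t)y$ is globally uniformly asymptotically stable). *)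

(* Defs.v *)
(* MathComp-Analysis, over an arbitrary [R : realType]. *)
From HB Require Import structures.
From mathcomp Require Import all_boot all_order all_algebra.
From mathcomp Require Import all_classical all_reals all_analysis.

Set Implicit Arguments.
Unset Strict Implicit.
Unset Printing Implicit Defensive.

Import Order.TTheory GRing.Theory Num.Theory.
Import numFieldNormedType.Exports.

Local Open Scope classical_set_scope.
Local Open Scope ring_scope.

(* The norm that the library puts on ['rV[R]_n] is the max norm; it induces the
   same topology. *)
Definition enorm (R : realType) (n : nat) (w : 'rV[R]_n) : R :=
  Num.sqrt (\sum_(i < n) w 0 i ^+ 2).

Definition supnorm (R : realType) (n : nat) (D : set R) (w : R -> 'rV[R]_n) : R :=
  sup [set enorm (w s) | s in D].

(* Functions on [0, oo) are total functions on [R] of which only the values on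
   [0, oo) matter. *)
Definition classK (R : realType) (g : R -> R) : Prop :=
  [/\ {within `[0, +oo[, continuous g}, g 0 = 0 &
      forall r s : R, 0 <= r -> r < s -> g r < g s].

Definition classKinf (R : realType) (g : R -> R) : Prop :=
  classK g /\ g r @[r --> +oo] --> +oo.

Definition classKL (R : realType) (s : R -> R -> R) : Prop :=
  [/\ {within [set p : R * R | 0 <= p.1 /\ 0 <= p.2],
         continuous (fun p : R * R => s p.1 p.2)},
      forall t : R, 0 <= t -> classK (fun r => s r t),
      forall r t1 t2 : R, 0 <= r -> 0 <= t1 -> t1 <= t2 -> s r t2 <= s r t1 &
      forall r : R, 0 <= r -> s r t @[t --> +oo] --> 0].

Definition USF (R : realType) (mu : R -> R) : Prop :=
  {within `[0, +oo[, continuous mu} /\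
  exists eps delta : R, [/\ 0 < eps, 0 <= delta &
    forall t0 t : R, 0 <= t0 -> t0 <= t ->
      \int[lebesgue_measure]_(s in `[t0, t]) mu s <= - eps * (t - t0) + delta].

(* C([-tau, 0], R^n): an element is represented by its unique extension by 0
   to the whole line, so that Leibniz equality of representatives is equality
   on [-tau, 0]. *)
Definition hist (R : realType) (tau : R) (n : nat) : set (R -> 'rV[R]_n) :=
  [set phi : R -> 'rV[R]_n | {within `[- tau, 0], continuous phi} /\
             forall theta : R, theta \notin `[- tau, 0] -> phi theta = 0].

Definition hnorm (R : realType) (tau : R) (n : nat) (phi : R -> 'rV[R]_n) : R :=
  supnorm `[- tau, 0] phi.

(* x_t *)
Definition seg (R : realType) (tau : R) (n : nat) (x : R -> 'rV[R]_n) (t : R) :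
    R -> 'rV[R]_n :=
  fun theta => if theta \in `[- tau, 0] then x (t + theta) else 0.

(* Lipschitz continuity in (t, phi) is local near each point and the constant
   may depend on u; uniform continuity in u is for fixed (t, phi). *)
Definition admissible_rhs (R : realType) (tau : R) (n l : nat)
    (f : R -> (R -> 'rV[R]_n) -> 'rV[R]_l -> 'rV[R]_n) : Prop :=
  [/\ forall (w : 'rV[R]_l) t phi, 0 <= t -> hist tau phi ->
        exists r L : R, 0 < r /\
          forall t1 t2 phi1 phi2, 0 <= t1 -> 0 <= t2 ->
            hist tau phi1 -> hist tau phi2 ->
            `|t1 - t| < r -> `|t2 - t| < r ->
            hnorm tau (phi1 \- phi) < r -> hnorm tau (phi2 \- phi) < r ->
            enorm (f t1 phi1 w - f t2 phi2 w)
              <= L * (`|t1 - t2| + hnorm tau (phi1 \- phi2)),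
      forall (t : R) (phi : R -> 'rV[R]_n), 0 <= t -> hist tau phi ->
        forall eps : R, 0 < eps -> exists delta : R, 0 < delta /\
          forall w1 w2 : 'rV[R]_l, enorm (w1 - w2) < delta ->
            enorm (f t phi w1 - f t phi w2) < eps &
      forall t : R, 0 <= t -> f t (fun=> 0) 0 = 0].

(* The real line with its Lebesgue (i.e. completed Borel) sigma-algebra. *)
Notation lebesgueType R := (caratheodory_type (@wlength R idfun)^*%mu).

(* Lebesgue measurable and essentially bounded on each bounded interval. *)
Definition input (R : realType) (l : nat) (u : R -> 'rV[R]_l) : Prop :=
  (forall i : 'I_l, measurable_fun (`[0, +oo[ : set (lebesgueType R))
     (fun t : lebesgueType R => u t 0 i)) /\
  (forall b : R, exists M : R,
     {ae lebesgue_measure, forall t : R, 0 <= t -> t <= b -> enorm (u t) <= M}).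

Definition Linf (R : realType) (l : nat) (u : R -> 'rV[R]_l) : Prop :=
  exists M : R, forall t : R, 0 <= t -> enorm (u t) <= M.

(* Absolute continuity on [a, b]; the disjoint intervals [p i, q i] are listed
   from left to right. *)
Definition abs_continuous (R : realType) (n : nat) (a b : R)
    (x : R -> 'rV[R]_n) : Prop :=
  forall eps : R, 0 < eps -> exists delta : R, 0 < delta /\
    forall (k : nat) (p q : nat -> R),
      (forall i, (i < k)%N -> [/\ a <= p i, p i <= q i & q i <= b]) ->
      (forall i, (i.+1 < k)%N -> q i <= p i.+1) ->
      \sum_(i < k) (q i - p i) < delta ->
      \sum_(i < k) enorm (x (q i) - x (p i)) < eps.

(* Carathéodory solutions of x' = f(t, x_t, u) on [t0, T), where T may be +oo;
   only the values of x on [t0 - tau, T) matter, and the initial condition is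
   [seg tau x t0]. *)
Definition solution (R : realType) (tau : R) (n l : nat)
    (f : R -> (R -> 'rV[R]_n) -> 'rV[R]_l -> 'rV[R]_n)
    (u : R -> 'rV[R]_l) (t0 : R) (T : \bar R) (x : R -> 'rV[R]_n) : Prop :=
  [/\ (t0%:E < T)%E,
      {within [set t : R | t0 - tau <= t /\ (t%:E < T)%E], continuous x},
      forall b : R, t0 <= b -> (b%:E < T)%E -> abs_continuous t0 b x &
      {ae lebesgue_measure, forall t : R, t0 < t -> (t%:E < T)%E ->
        forall i : 'I_n,
          is_derive t 1 (fun s : R => x s 0 i) (f t (seg tau x t) (u t) 0 i)}].

Definition ISS (R : realType) (tau : R) (n l : nat)
    (f : R -> (R -> 'rV[R]_n) -> 'rV[R]_l -> 'rV[R]_n) : Prop :=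
  exists (sigma : R -> R -> R) (gamma1 : R -> R),
    [/\ classKL sigma, classK gamma1 &
    forall (u : R -> 'rV[R]_l) (t0 : R) (T : \bar R) (x : R -> 'rV[R]_n),
      input u -> Linf u -> 0 <= t0 -> solution tau f u t0 T x ->
      forall t : R, t0 <= t -> (t%:E < T)%E ->
        enorm (x t) <= sigma (hnorm tau (seg tau x t0)) (t - t0)
                       + gamma1 (supnorm `[t0, t] u)].

Definition iISS (R : realType) (tau : R) (n l : nat)
    (f : R -> (R -> 'rV[R]_n) -> 'rV[R]_l -> 'rV[R]_n) : Prop :=
  exists (sigma : R -> R -> R) (gamma1 gamma2 : R -> R),
    [/\ classKL sigma, classK gamma1, classK gamma2 &
    forall (u : R -> 'rV[R]_l) (t0 : R) (T : \bar R) (x : R -> 'rV[R]_n),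
      input u -> 0 <= t0 -> solution tau f u t0 T x ->
      forall t : R, t0 <= t -> (t%:E < T)%E ->
        enorm (x t) <= sigma (hnorm tau (seg tau x t0)) (t - t0)
          + gamma1 (\int[@completed_lebesgue_measure R]_(s in `[t0, t])
                      gamma2 (enorm (u s)))].

Definition GUAS (R : realType) (tau : R) (n l : nat)
    (f : R -> (R -> 'rV[R]_n) -> 'rV[R]_l -> 'rV[R]_n) : Prop :=
  exists sigma : R -> R -> R, classKL sigma /\
    forall (t0 : R) (T : \bar R) (x : R -> 'rV[R]_n),
      0 <= t0 -> solution tau f (fun=> 0) t0 T x ->
      forall t : R, t0 <= t -> (t%:E < T)%E ->
        enorm (x t) <= sigma (hnorm tau (seg tau x t0)) (t - t0).

Definition GUES (R : realType) (tau : R) (n l : nat)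
    (f : R -> (R -> 'rV[R]_n) -> 'rV[R]_l -> 'rV[R]_n) : Prop :=
  exists alpha beta : R, [/\ 0 < alpha, 0 < beta &
    forall (t0 : R) (T : \bar R) (x : R -> 'rV[R]_n),
      0 <= t0 -> solution tau f (fun=> 0) t0 T x ->
      forall t : R, t0 <= t -> (t%:E < T)%E ->
        enorm (x t) <= beta * expR (- alpha * (t - t0)) * hnorm tau (seg tau x t0)].

(* A continuous map from [-tau, oo) x C([-tau, 0], R^n) to [0, oo). *)
Definition functional (R : realType) (tau : R) (n : nat)
    (V : R -> (R -> 'rV[R]_n) -> R) : Prop :=
  forall (t : R) (phi : R -> 'rV[R]_n), - tau <= t -> hist tau phi ->
    0 <= V t phi /\
    forall eps : R, 0 < eps -> exists delta : R, 0 < delta /\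
      forall s psi, - tau <= s -> hist tau psi ->
        `|s - t| < delta -> hnorm tau (psi \- phi) < delta ->
        `|V s psi - V t phi| < eps.

(* Upper right Dini derivative; it is the derivative wherever that exists. *)
Definition dini (R : realType) (v : R -> R) (t : R) : \bar R :=
  limf_esup (fun h : R => ((v (t + h) - v t) / h)%:E) (0 : R)^'+.

(* "v'(t) <= g t whenever P t", for t in [t0, T).  Solutions are differentiable
   only almost everywhere, so the inequality is required at almost every t.  At
   the exceptional t the derivative must still not be +oo: otherwise v could
   grow on a null set, like the Cantor function, unseen by its derivative.
   This covers functions v that are differentiable everywhere and, when P is
   always true and g is locally essentially bounded, those that are locally
   absolutely continuous. *)
Definition rate_le (R : realType) (t0 : R) (T : \bar R)
    (v : R -> R) (P : R -> Prop) (g : R -> R) : Prop :=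
  (forall t : R, t0 <= t -> (t%:E < T)%E -> P t -> (dini v t < +oo)%E) /\
  {ae lebesgue_measure, forall t : R, t0 <= t -> (t%:E < T)%E -> P t ->
     (dini v t <= (g t)%:E)%E}.

Definition h1 (R : realType) (tau : R) (n : nat)
    (V : R -> (R -> 'rV[R]_n) -> R) (alpha1 alpha2 : R -> R) : Prop :=
  forall (t : R) (phi : R -> 'rV[R]_n), 0 <= t -> hist tau phi ->
    alpha1 (enorm (phi 0)) <= V t phi /\ V t phi <= alpha2 (hnorm tau phi).

Definition h2 (R : realType) (tau : R) (n l : nat)
    (f : R -> (R -> 'rV[R]_n) -> 'rV[R]_l -> 'rV[R]_n)
    (V : R -> (R -> 'rV[R]_n) -> R) (mu varpi : R -> R) : Prop :=
  forall (u : R -> 'rV[R]_l) (t0 : R) (T : \bar R) (x : R -> 'rV[R]_n),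
    input u -> 0 <= t0 -> solution tau f u t0 T x ->
    rate_le t0 T (fun t => V t (seg tau x t))
      (fun t => varpi (enorm (u t)) <= V t (seg tau x t))
      (fun t => mu t * V t (seg tau x t)).

Definition h3 (R : realType) (tau : R) (n l : nat)
    (f : R -> (R -> 'rV[R]_n) -> 'rV[R]_l -> 'rV[R]_n)
    (V : R -> (R -> 'rV[R]_n) -> R) (mu varpi1 varpi2 : R -> R) : Prop :=
  forall (u : R -> 'rV[R]_l) (t0 : R) (T : \bar R) (x : R -> 'rV[R]_n),
    input u -> 0 <= t0 -> solution tau f u t0 T x ->
    rate_le t0 T (fun t => V t (seg tau x t)) (fun=> True)
      (fun t => (varpi1 (enorm (u t)) + mu t) * V t (seg tau x t)
                + varpi2 (enorm (u t))).

(* With u = 0, as it is used for GUAS and GUES. *)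
Definition h4 (R : realType) (tau : R) (n l : nat)
    (f : R -> (R -> 'rV[R]_n) -> 'rV[R]_l -> 'rV[R]_n)
    (V : R -> (R -> 'rV[R]_n) -> R) (mu : R -> R) : Prop :=
  forall (t0 : R) (T : \bar R) (x : R -> 'rV[R]_n),
    0 <= t0 -> solution tau f (fun=> 0) t0 T x ->
    rate_le t0 T (fun t => V t (seg tau x t)) (fun=> True)
      (fun t => mu t * V t (seg tau x t)).

Definition power_bounds (R : realType) (alpha1 alpha2 : R -> R) : Prop :=
  exists beta0 beta1 beta2 : R, [/\ 0 < beta0, 0 < beta1, 0 < beta2 &
    forall s : R, 0 <= s ->
      alpha1 s = beta1 * s `^ beta0 /\ alpha2 s = beta2 * s `^ beta0].

(* Main.v *)
(* Along a solution, v(t) = V(t, x_t) is continuous.  A continuous function whose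
   upper right Dini derivative is < +oo everywhere and <= 0 almost everywhere is
   nonincreasing: a nondecreasing h with h' = +oo on the exceptional null set and
   arbitrarily small total variation absorbs what could happen there.  Applied
   to v(s) exp(-M(s) - Z(s)) - c Z(s), where M is a primitive of mu, Z one of
   g = varpi1(|u|) + varpi2(|u|) and c = exp(delta - M(b)), this gives
     v(b) <= exp(Z(b)) (exp(-eps (b - a) + delta) v(a) + exp(delta) Z(b)),
   which is iISS after composing with the inverse of alpha1.  The other three
   parts are the case g = 0; for ISS it is applied from the last time at which
   v <= varpi(sup |u|). *)
Require Import Defs.
From HB Require Import structures.
From mathcomp Require Import all_boot all_order all_algebra.
From mathcomp Require Import all_classical all_reals all_analysis.
From mathcomp Require Import measurable_realfun ring lra.

Set Implicit Arguments.
Unset Strict Implicit.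
Unset Printing Implicit Defensive.

Import Order.TTheory GRing.Theory Num.Theory.
Import numFieldNormedType.Exports.

Local Open Scope classical_set_scope.
Local Open Scope ring_scope.

(** * Null sets and monotonicity from Dini derivatives *)

(** Cover the null set by open sets [U k] of measure at most [e / 2 ^ k.+1] and let [h t] sum the
    measures of the parts of [U k] to the left of [t]. The total is at most [e], and a point of [E]
    has a neighbourhood inside the first [m] sets, so to its right [h] grows at rate at least [m],
    for every [m]. *)
Lemma null_set_majorant (R : realType) (E : set R) (e : R) :
  (@lebesgue_measure R).-negligible E -> 0 < e ->
  exists h : R -> R, [/\ {homo h : s t / s <= t}, forall t, 0 <= h t <= e &
    forall t (K : R), E t -> \forall d \near 0^'+, h t + K * d <= h (t + d)].
Proof.
move=> [N [mN N0 EN]] e0.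
pose lam : {measure set (measurableTypeR R) -> \bar R} := @lebesgue_measure R.
have ek_gt0 k : 0 < e / (2 ^ k.+1)%:R by rewrite divr_gt0// ltr0n expn_gt0.
have lamN0 : lam N = 0%E by exact: N0.
have Nlty : (lam N < +oo)%E by rewrite lamN0.
pose U k := sval (cid (lebesgue_regularity_outer mN Nlty (ek_gt0 k))).
have UP k : [/\ open (U k), N `<=` U k & (lam (U k) <= (e / (2 ^ k.+1)%:R)%:E)%E].
  rewrite /U; case: cid => V /= [oV NV VN]; split=> //.
  have mV := open_measurable oV.
  (* Outer regularity bounds only the measure of [V] minus [N]; as [N] is null, [V] itself is as
     small. *)
  have -> : lebesgue_measure V = (lam (V `\` N) + lam N)%E.
    by rewrite -measureU ?setDKU//; [exact: measurableD|rewrite setIC setDIK].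
  by rewrite lamN0 adde0 ltW.
have mU k : @measurable _ (measurableTypeR R) (U k) by case: (UP k) => /open_measurable.
have mr t : @measurable _ (measurableTypeR R) `]-oo, t]%classic by exact: measurable_itv.
pose a k t := lam (U k `&` `]-oo, t]).
have a0 k t : (0 <= a k t)%E by exact: measure_ge0.
pose H t := (\sum_(0 <= k <oo) a k t)%E.
have H0 t : (0 <= H t)%E by exact: nneseries_ge0.
have He t : (H t <= e%:E)%E.
  apply: (le_trans _ (epsilon_trick0 xpredT (ltW e0))).
  apply: lee_nneseries => // k _; case: (UP k) => _ _; apply: le_trans.
  by apply: le_measure; rewrite ?inE//; exact: measurableI.
have Hfin t : H t \is a fin_num by rewrite ge0_fin_numE// (le_lt_trans (He t)) ?ltry.
have aS k s t : s <= t -> (a k s <= a k t)%E.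
  move=> st; apply: le_measure; rewrite ?inE; try exact: measurableI.
  by apply: setIS; apply: subset_itvl; rewrite bnd_simp.
exists (fun t => fine (H t)); split.
- by move=> s t st; apply: fine_le => //; apply: lee_nneseries => // k _; exact: aS.
- by move=> t; rewrite fine_ge0//= -lee_fin fineK.
- move=> t K Et; pose m := (Num.truncn K).+1.
  have Km : K <= m%:R by rewrite ltW// truncnS_gt.
  have /(_ m) [r r0 rU] : forall j, exists2 r : R, 0 < r &
      forall k, (k < j)%N -> ball t r `<=` U k.
    elim=> [|j [r r0 IH]]; first by exists 1.
    have [oU NU _] := UP j.
    have /nbhs_ballP[r' /= r'0 r'U] := open_nbhs_nbhs (conj oU (NU _ (EN _ Et))).
    exists (Num.min r r'); first by rewrite lt_min r0.
    move=> k; rewrite ltnS leq_eqVlt => /predU1P[->|kj].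
      by apply: subset_trans r'U; apply: le_ball; rewrite ge_min lexx orbT.
    by apply: subset_trans (IH _ kj); apply: le_ball; rewrite ge_min lexx.
  near=> d.
  have d0 : 0 < d by near: d; exact: nbhs_right_gt.
  have dr : d < r by near: d; exact: nbhs_right_lt.
  rewrite -lee_fin EFinD !fineK//.
  (* near [t] the sets [U 0], ..., [U m.-1] contribute [m * d] to [h (t + d) - h t] *)
  pose b k := if (k < m)%N then d%:E else 0%E.
  have b0 k : (0 <= b k)%E by rewrite /b; case: ifP => // _; rewrite lee_fin ltW.
  apply: (@le_trans _ _ (H t + \sum_(0 <= k <oo) b k)%E).
    apply: leeD => //; apply: le_trans (nneseries_lim_ge m _) => //.
    rewrite (eq_big_nat _ _ (F2 := fun=> d%:E)); last first.
      by move=> k /andP[_ km]; rewrite /b km.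
    by rewrite sumEFin lee_fin big_const_nat subn0 iter_addr_0 -mulr_natl ler_pM2r.
  rewrite -nneseriesD//; apply: lee_nneseries => [k _ _|k _]; first exact: adde_ge0.
  rewrite /b; case: ifP => km; last by rewrite adde0 aS// lerDl ltW.
  have -> : d%:E = lam `]t, t + d]%classic.
    apply/esym; rewrite [LHS]lebesgue_measure_itv /= lte_fin ltrDl d0 -EFinB.
    by rewrite (addrC t) addrK.
  rewrite -measureU; [|exact: measurableI|exact: measurable_itv|]; last first.
    apply/seteqP; split=> // y []/= [_]; rewrite !in_itv/= => yt /andP[ty _].
    by move: (lt_le_trans ty yt); rewrite ltxx.
  apply: le_measure; rewrite ?inE; [apply: measurableU; last exact: measurable_itv|..];
    try exact: measurableI.
  move=> y [[Uy]|]/=; rewrite !in_itv/=.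
    by move=> yt; split=> //; rewrite (le_trans yt)// lerDl ltW.
  move=> /andP[ty yd]; split=> //; apply: (rU _ km).
  rewrite /ball/= ltr_distlC; apply/andP; split; first by rewrite (lt_trans _ ty)// ltrBlDr ltrDl.
  by rewrite (le_lt_trans yd)// ltrD2l.
Unshelve. all: by end_near. Qed.

Lemma dini_lt (R : realType) (v : R -> R) (t c : R) : (dini v t < c%:E)%E ->
  \forall d \near 0^'+, v (t + d) <= v t + c * d.
Proof.
rewrite /dini limf_esupE => /ereal_inf_lt[_ [A /= A0 <-] supA].
near=> d; have d0 : 0 < d by near: d; exact: nbhs_right_gt.
have Ad : A d by near: d.
have : (((v (t + d) - v t) / d)%:E < c%:E)%E.
  by apply: le_lt_trans supA; apply: ereal_sup_ubound; exists d.
by rewrite lte_fin ltr_pdivrMr// => /ltW; rewrite lerBlDl.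
Unshelve. all: by end_near. Qed.

Lemma dini_lty (R : realType) (v : R -> R) (t : R) : (dini v t < +oo)%E ->
  exists K, \forall d \near 0^'+, v (t + d) <= v t + K * d.
Proof.
(* For a derivative equal to [-oo], slope 0 works. *)
case E : (dini v t) => [r| |]// _; [exists (r + 1)|exists 0];
  by apply: dini_lt; rewrite E ?ltNyr// lte_fin ltrDl.
Qed.

(** The graph of [w] cannot cross above [g t = w a + e * (t - a) + h t], with [h] the majorant of
    the exceptional null set: at a good point [w] has upper right slope at most [e], at an
    exceptional one [h] outgrows any [K]. At [b] this costs at most [e * (b - a) + e], which is the
    arbitrary [e']. *)
Lemma ae_dini_nonincreasing_closed (R : realType) (a b : R) (w : R -> R) : a <= b ->
  {within `[a, b], continuous w} ->
  (forall t, a <= t -> t < b ->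
     exists K, \forall d \near 0^'+, w (t + d) <= w t + K * d) ->
  {ae lebesgue_measure, forall t, a <= t -> t < b ->
     forall e : R, 0 < e -> \forall d \near 0^'+, w (t + d) <= w t + e * d} ->
  w b <= w a.
Proof.
move=> ab wcont wK wae; apply/ler_addgt0Pr => e' e'0.
pose e := e' / (b - a + 1); have ba1 : 0 < b - a + 1 by rewrite ltr_pwDr// subr_ge0.
have e0 : 0 < e by rewrite divr_gt0.
have [h [hS h0 hE]] := null_set_majorant wae e0.
pose g t := w a + e * (t - a) + h t.
have gS s t : s <= t -> g s <= g t.
  by move=> st; rewrite /g lerD ?hS// lerD2l ler_pM2l// lerD2r.
pose S := [set t | a <= t <= b /\ w t <= g t].
have Sa : S a.
  split; first by rewrite lexx.
  by rewrite /g subrr mulr0 addr0 lerDl; case/andP: (h0 a).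
have supS : has_sup S by split; [exists a|exists b => t [/andP[]]].
pose c := sup S.
have ac : a <= c by apply: (sup_upper_bound supS).
have cb : c <= b by apply: ge_sup; [exists a|move=> t [/andP[]]].
(* Monotonicity of [g] is enough here: if [w c > g c], continuity gives [w t > g c >= g t] at points
   [t] of [S] close to [c]. *)
have wc : w c <= g c.
  rewrite leNgt; apply/negP => gw.
  have /subspace_continuousP/(_ c) := wcont.
  rewrite /= in_itv/= ac cb => /(_ isT)/cvgr_gt /(_ _ gw).
  rewrite /within/= => /nbhs_ballP[r /= r0 rw].
  have [t [tab tS] tc] := sup_adherent r0 supS.
  have tlec : t <= c by apply: (sup_upper_bound supS); split.
  have : g c < w t.
    apply: rw; last by rewrite in_itv.
    by rewrite /ball/= ger0_norm ?subr_ge0// ltrBlDr -ltrBlDl.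
  by rewrite ltNge (le_trans tS)// gS.
have [bc|{}cb] := leP b c.
  have cE : c = b by apply/eqP; rewrite eq_le cb.
  rewrite cE in wc; apply: (le_trans wc).
  have /andP[_ hb] := h0 b.
  rewrite /g -addrA lerD2l (le_trans (lerD (lexx _) hb))//.
  by rewrite -[X in _ + X]mulr1 -mulrDr /e divfK// gt_eqF.
suff /filter_ex : \forall d \near 0^'+, 0 < d /\ S (c + d).
  case=> d [d0 Scd]; have := sup_upper_bound supS Scd.
  by rewrite gerDl leNgt d0.
have cbd : \forall d \near 0^'+, [/\ 0 < d, a <= c + d & c + d <= b].
  near=> d; have d0 : 0 < d by near: d; exact: nbhs_right_gt.
  split=> //; first by rewrite (le_trans ac)// lerDl ltW.
  by rewrite -lerBrDl; near: d; apply: nbhs_right_le; rewrite subr_gt0.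
have [Ec|/contrapT nEc] := pselect
    (~ forall e : R, 0 < e -> \forall d \near 0^'+, w (c + d) <= w c + e * d).
  have [K wKc] := wK _ ac cb.
  have hKc : \forall d \near 0^'+, h c + K * d <= h (c + d).
    by apply: hE => /(_ ac cb)/Ec.
  near=> d; have [d0 acd cdb] : [/\ 0 < d, a <= c + d & c + d <= b] by near: d.
  split=> //; split; first by rewrite acd.
  have : w (c + d) <= w c + K * d by near: d.
  have : h c + K * d <= h (c + d) by near: d.
  have := mulr_gt0 e0 d0.
  by move: wc; rewrite /g; lra.
have wec := nEc _ e0.
near=> d; have [d0 acd cdb] : [/\ 0 < d, a <= c + d & c + d <= b] by near: d.
split=> //; split; first by rewrite acd.
have : w (c + d) <= w c + e * d by near: d.
have : h c <= h (c + d) by rewrite hS// lerDl ltW.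
by move: wc; rewrite /g; lra.
Unshelve. all: by end_near. Qed.

(** Reduces to the previous lemma by continuity at [a]: if [w a < w b], then [w s < w b] for some
    [s > a] near [a], a contradiction on [[s, b]]. Only interior points enter because primitives are
    differentiated only there. *)
Lemma ae_dini_nonincreasing (R : realType) (a b : R) (w : R -> R) : a <= b ->
  {within `[a, b], continuous w} ->
  (forall t, a < t -> t < b ->
     exists K, \forall d \near 0^'+, w (t + d) <= w t + K * d) ->
  {ae lebesgue_measure, forall t, a < t -> t < b ->
     forall e : R, 0 < e -> \forall d \near 0^'+, w (t + d) <= w t + e * d} ->
  w b <= w a.
Proof.
rewrite le_eqVlt => /predU1P[->//|ab] wcont wK wae; rewrite leNgt; apply/negP => wab.
have /subspace_continuousP/(_ a) := wcont.
rewrite /= in_itv/= lexx ltW// => /(_ isT)/cvgr_lt /(_ _ wab).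
rewrite /within/= => /nbhs_ballP[r /= r0 rw].
pose s := Num.min (a + r / 2) b.
have as_ : a < s by rewrite lt_min ab ltrDl divr_gt0.
have sb : s <= b by rewrite ge_min lexx orbT.
have : w s < w b.
  apply: rw; last by rewrite in_itv/= sb ltW.
  rewrite /ball/= distrC ger0_norm ?subr_ge0 ?(ltW as_)// ltrBlDl.
  by rewrite gt_min; apply/orP; left; lra.
rewrite ltNge => /negP; apply; apply: ae_dini_nonincreasing_closed => //.
- apply: continuous_subspaceW wcont; apply: subset_itvr.
  by rewrite bnd_simp ltW.
- by move=> t st tb; apply: wK => //; exact: lt_le_trans as_ st.
- apply: filterS wae; first exact: (ae_filter_ringOfSetsType lebesgue_measure).
  by move=> t wt st tb; apply: wt => //; exact: lt_le_trans as_ st.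
Qed.

(** * Comparison for a linear differential inequality *)

Lemma near_cvg (T : Type) (U : topologicalType) (F : set_system T) {FF : Filter F}
    (f g : T -> U) (l : U) :
  (\forall x \near F, f x = g x) -> f x @[x --> F] --> l -> g x @[x --> F] --> l.
Proof. by move=> fg; apply: cvg_trans; apply: near_eq_cvg. Qed.

(** One-sided chain rule for [expR (- y)] at 0. Applying [1 + y <= expR y] to [y] and to [- y]
    squeezes the quotient between [- (y / d)] and [- (y / d) / (1 + y)]. *)
Lemma expRN_quotient_cvg (R : realType) (y : R -> R) (l : R) :
  y d / d @[d --> 0^'+] --> l ->
  (expR (- y d) - 1) / d @[d --> 0^'+] --> - l /\ expR (- y d) @[d --> 0^'+] --> (1 : R).
Proof.
move=> yl.
have id0 : (d : R) @[d --> 0^'+] --> (0 : R) by exact: cvg_at_right_filter.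
have y0 : y d @[d --> 0^'+] --> (0 : R).
  rewrite -[X in _ --> X](mulr0 l); apply: near_cvg _ (cvgM yl id0); near=> d.
  by rewrite /= divfK// gt_eqF//; near: d; exact: nbhs_right_gt.
have y1 : 1 + y d @[d --> 0^'+] --> (1 : R).
  by rewrite -[X in _ --> X]addr0; apply: cvgD => //; exact: cvg_cst.
have quot : (expR (- y d) - 1) / d @[d --> 0^'+] --> - l.
  apply: (@squeeze_cvgr _ _ _ _ (fun d => - (y d / d)) (fun d => - (y d / d) / (1 + y d))).
  - near=> d; have d0 : 0 < d by near: d; exact: nbhs_right_gt.
    have yd : 0 < 1 + y d by near: d; apply: (cvgr_gt _ y1); exact: ltr01.
    apply/andP; split.
      by rewrite -mulNr ler_pM2r ?invr_gt0// lerBrDl expR_ge1Dx.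
    have -> : - (y d / d) / (1 + y d) = - y d / (1 + y d) / d by ring.
    rewrite ler_pM2r ?invr_gt0// lerBlDl.
    have -> : 1 + - y d / (1 + y d) = (1 + y d)^-1 by field; rewrite gt_eqF.
    by rewrite expRN lef_pV2 ?posrE ?expR_gt0// expR_ge1Dx.
  - exact: cvgN.
  - rewrite -[X in _ --> X]divr1; apply: cvgM; first exact: cvgN.
    by apply: cvgV => //; exact: oner_neq0.
split=> //.
have : 1 + (expR (- y d) - 1) / d * d @[d --> 0^'+] --> 1 + - l * 0.
  by apply: cvgD; [exact: cvg_cst|exact: cvgM].
rewrite mulr0 addr0; apply: near_cvg; near=> d.
rewrite /= divfK ?subrKC// gt_eqF//; near: d; exact: nbhs_right_gt.
Unshelve. all: by end_near. Qed.

(** The integrating factor [E] cancels the term [(g + mu) * v] and leaves the forcing [g * E]. Since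
    [M t >= M b - delta] and [Z t >= 0], one has [E t <= c], so subtracting [c * Z] absorbs the
    forcing and [w] is nonincreasing. *)
Lemma ae_dini_comparison (R : realType) (a b delta : R) (v g mu Z M : R -> R) :
  a <= b ->
  {within `[a, b], continuous v} -> {within `[a, b], continuous Z} ->
  {within `[a, b], continuous M} ->
  (forall t, a <= t <= b -> 0 <= v t) -> (forall t, 0 <= g t) ->
  {in `[a, b] &, {homo Z : s t / s <= t}} -> Z a = 0 -> M a = 0 ->
  (forall t, a <= t <= b -> M b - M t <= delta) ->
  (forall t, a < t -> t < b -> (M (t + d) - M t) / d @[d --> 0^'+] --> mu t) ->
  {ae lebesgue_measure, forall t, a < t -> t < b ->
     (Z (t + d) - Z t) / d @[d --> 0^'+] --> g t} ->
  (forall t, a < t -> t < b -> (dini v t < +oo)%E) ->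
  {ae lebesgue_measure, forall t, a < t -> t < b ->
     (dini v t <= ((g t + mu t) * v t + g t)%:E)%E} ->
  v b <= expR (Z b) * (expR (M b) * v a + expR delta * Z b).
Proof.
move=> ab vc Zc Mc v0 g0 Zmono Za Ma Md dM dZ vlty vle.
pose c := expR (delta - M b); pose E t := expR (- (M t + Z t)).
pose w t := v t * E t - c * Z t.
have aI : a \in `[a, b] by rewrite in_itv/= ab lexx.
have ES t d : E (t + d) = E t * expR (- (M (t + d) - M t + (Z (t + d) - Z t))).
  by rewrite /E -expRD; congr expR; ring.
have Egt0 t : 0 < E t by exact: expR_gt0.
have Zge0 t : t \in `[a, b] -> 0 <= Z t.
  by move=> tI; rewrite -Za Zmono//; move: tI; rewrite in_itv/= => /andP[].
have c0 : 0 < c by exact: expR_gt0.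
have near_ab t : a < t -> t < b -> \forall d \near 0^'+, 0 < d /\ t + d \in `[a, b].
  move=> at' tb; near=> d; have d0 : 0 < d by near: d; exact: nbhs_right_gt.
  have dt : d <= b - t by near: d; apply: nbhs_right_le; rewrite subr_gt0.
  by split=> //; rewrite in_itv/=; apply/andP; split; lra.
(* Multiplication by [expR (M b + Z b)] turns this into the claim, as
   [c * expR (M b) = expR delta]. *)
suff : w b <= w a.
  rewrite /w Za mulr0 subr0 lerBlDr {2}/E Ma Za addr0 oppr0 expR0 mulr1.
  rewrite /E expRN -ler_pdivlMr ?invr_gt0 ?expR_gt0// invrK => /le_trans; apply.
  rewrite le_eqVlt; apply/orP; left; apply/eqP.
  by rewrite /c expRB expRD; field; rewrite gt_eqF ?expR_gt0.
apply: ae_dini_nonincreasing => //.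
- have Ec : {within `[a, b], continuous E}.
    apply: (@within_continuous_comp R R R _ (fun s => - (M s + Z s)) expR).
      by move=> x _; exact: continuous_expR.
    by move=> t; exact: (cvgN (cvgD (Mc t) (Zc t))).
  move=> t; apply: cvgB; first exact: cvgM (vc t) (Ec t).
  exact: cvgM (cvg_cst _) (Zc t).
(* This must also cover points where [Z] has no derivative. There [Z] enters [w] only through
   [expR (- Z)] and [- c * Z], which do not increase, so with [v >= 0] a finite slope for [v] and
   the derivative of [M] suffice. *)
- move=> t at' tb; have [K0 vK0] := dini_lty (vlty t at' tb).
  pose m d := M (t + d) - M t.
  have [mq m1] := expRN_quotient_cvg (dM _ at' tb).
  pose K := E t * (v t * - mu t + K0 * 1).
  have cK : E t * (v t * ((expR (- m d) - 1) / d) + K0 * expR (- m d)) @[d --> 0^'+] --> K.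
    exact: (cvgM (cvg_cst _) (cvgD (cvgM (cvg_cst _) mq) (cvgM (cvg_cst _) m1))).
  have KK : K < K + 1 by rewrite ltrDl.
  have nK := cvgr_lt _ cK _ KK.
  have nab := near_ab t at' tb.
  exists (K + 1); near=> d.
  have [d0 tdI] : 0 < d /\ t + d \in `[a, b] by near: d.
  have tI : t \in `[a, b] by rewrite in_itv/= !ltW.
  have Ztd : Z t <= Z (t + d) by rewrite Zmono// lerDl ltW.
  have vtd : v (t + d) <= v t + K0 * d by near: d.
  have vtd0 : 0 <= v (t + d) by rewrite v0// -in_itv.
  have eb : v (t + d) * E (t + d) <= E t * ((v t + K0 * d) * expR (- m d)).
    rewrite ES mulrCA ler_pM2l//; rewrite ler_pM ?expR_ge0//.
    by rewrite ler_expR lerN2 /m lerDl subr_ge0.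
  have : E t * (v t * ((expR (- m d) - 1) / d) + K0 * expR (- m d)) < K + 1.
    by near: d; exact: nK.
  rewrite -(ltr_pM2r d0); set q := _ - 1.
  have -> : E t * (v t * (q / d) + K0 * expR (- m d)) * d =
      E t * ((v t + K0 * d) * expR (- m d)) - E t * v t.
    by rewrite /q; field; rewrite gt_eqF.
  have := ler_wpM2l (ltW c0) Ztd; rewrite /w; lra.
- apply: filterS2 dZ vle; first exact: (ae_filter_ringOfSetsType lebesgue_measure).
  move=> t dZt vlet at' tb e e0.
  have {}dZt := dZt at' tb; have {}vlet := vlet at' tb.
  pose y d := M (t + d) - M t + (Z (t + d) - Z t).
  have yl : y d / d @[d --> 0^'+] --> mu t + g t.
    by under eq_fun do rewrite /y mulrDl; apply: cvgD => //; exact: dM.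
  have [yq y1] := expRN_quotient_cvg yl.
  (* The margin [e / E t / 2] becomes [e / 2] after multiplication by [E t], so the limiting slope
     of [w] stays strictly below [e]. *)
  pose L := (g t + mu t) * v t + g t + e / E t / 2.
  have vL : \forall d \near 0^'+, v (t + d) <= v t + L * d.
    apply: dini_lt; apply: le_lt_trans vlet _.
    by rewrite lte_fin ltrDl !divr_gt0.
  have Ec : E t <= c.
    rewrite /E /c ler_expR opprD; have tI : a <= t <= b by rewrite !ltW.
    have := Md _ tI; have : 0 <= Z t by rewrite Zge0// in_itv.
    lra.
  have le : E t * (v t * - (mu t + g t) + L * 1) - c * g t < e.
    have -> : E t * (v t * - (mu t + g t) + L * 1) - c * g t = e / 2 - (c - E t) * g t.
      by rewrite /L; field; rewrite gt_eqF.
    have : 0 <= (c - E t) * g t by rewrite mulr_ge0// subr_ge0.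
    lra.
  have ce : E t * (v t * ((expR (- y d) - 1) / d) + L * expR (- y d))
      - c * ((Z (t + d) - Z t) / d) @[d --> 0^'+]
      --> E t * (v t * - (mu t + g t) + L * 1) - c * g t.
    exact: (cvgB (cvgM (cvg_cst _) (cvgD (cvgM (cvg_cst _) yq)
      (cvgM (cvg_cst _) y1))) (cvgM (cvg_cst _) dZt)).
  have ne := cvgr_lt _ ce _ le.
  have nab := near_ab t at' tb.
  near=> d.
  have [d0 tdI] : 0 < d /\ t + d \in `[a, b] by near: d.
  have vtd : v (t + d) <= v t + L * d by near: d.
  have eb : v (t + d) * E (t + d) <= E t * ((v t + L * d) * expR (- y d)).
    by rewrite ES mulrCA ler_pM2l// ler_pM2r// expR_gt0.
  have : E t * (v t * ((expR (- y d) - 1) / d) + L * expR (- y d))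
      - c * ((Z (t + d) - Z t) / d) < e.
    by near: d; exact: ne.
  rewrite -(ltr_pM2r d0); set q := _ - 1.
  have -> : (E t * (v t * (q / d) + L * expR (- y d)) - c * ((Z (t + d) - Z t) / d)) * d =
      E t * ((v t + L * d) * expR (- y d)) - E t * v t - c * (Z (t + d) - Z t).
    by rewrite /q; field; rewrite gt_eqF.
  rewrite /w; lra.
Unshelve. all: by end_near. Qed.

(** * Comparison functions *)

Lemma classK_le (R : realType) (g : R -> R) (r s : R) :
  classK g -> 0 <= r -> r <= s -> g r <= g s.
Proof.
by move=> [_ _ glt] r0; rewrite le_eqVlt => /predU1P[->//|rs]; exact/ltW/glt.
Qed.

Lemma classK_ge0 (R : realType) (g : R -> R) (r : R) : classK g -> 0 <= r -> 0 <= g r.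
Proof. by move=> gK r0; case: (gK) => _ <- _; exact: classK_le. Qed.

(** Clamping at 0 leaves [g] unchanged on [[0, +oo[]; composition, measurability and integration can
    then be handled on the whole line. *)
Lemma within_continuous_max0 (R : realType) (g : R -> R) :
  {within `[0, +oo[, continuous g} -> continuous (fun r : R => g (Num.max 0 r)).
Proof.
move=> gc x; have /subspace_continuousP/(_ (Num.max 0 x)) := gc.
rewrite /= in_itv/= le_max lexx => /(_ isT) gx.
apply: (@cvg_comp _ _ _ (Num.max 0) g _ _ _ _ gx).
have mx : Num.max 0 y @[y --> x] --> Num.max 0 x.
  exact: (@continuous_max R R (fun=> 0) id x (cvg_cst _) cvg_id).
move=> P WP; have : \forall y \near x, `[0, +oo[%classic (Num.max 0 y) -> P (Num.max 0 y).
  exact: mx WP.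
apply: filterS => y; apply.
by rewrite /= in_itv/= le_max lexx.
Qed.

Lemma classK_continuous_max0 (R : realType) (g : R -> R) :
  classK g -> continuous (fun r : R => g (Num.max 0 r)).
Proof. by case=> /within_continuous_max0. Qed.

Lemma continuous_classK (R : realType) (g : R -> R) : continuous g -> g 0 = 0 ->
  (forall r s, 0 <= r -> r < s -> g r < g s) -> classK g.
Proof. by move=> gc g0 glt; split=> //; exact: continuous_subspaceT. Qed.

Lemma classK_comp (R : realType) (g h : R -> R) :
  classK g -> classK h -> classK (g \o h).
Proof.
move=> gK hK; have [_ g0 glt] := gK; have [_ h0 hlt] := hK; split=> /=.
- apply: (@subspace_eq_continuous _ _ _
      ((g \o Num.max 0) \o (h \o Num.max 0) : R -> R)).
    move=> r; rewrite inE/= in_itv/= andbT => r0 /=.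
    by rewrite (max_r r0) max_r ?classK_ge0.
  apply: continuous_subspaceT => r; apply: continuous_comp.
    exact: classK_continuous_max0.
  exact: classK_continuous_max0.
- by rewrite h0.
- by move=> r s r0 rs; apply: glt; [exact: classK_ge0|exact: hlt].
Qed.

(** Divergence and the intermediate value theorem make [g] surjective onto [[0, +oo[], and [h] is a
    choice of preimages. Strict monotonicity of [g] makes [h] increasing and continuous. *)
Lemma classKinf_inverse (R : realType) (g : R -> R) : classKinf g ->
  exists h, classK h /\ forall r, 0 <= r -> h (g r) = r.
Proof.
move=> [gK goo]; have [gc g0 glt] := gK.
have surj (y : R) : exists r, 0 <= y -> 0 <= r /\ g r = y.
  have [y0|] := leP 0 y; last by exists 0.
  have [B [B0 yB]] : exists B, 0 <= B /\ y <= g B.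
    apply/not_existsP => nB.
    have /cvgryPge/(_ y) := goo.
    move=> ny; have /filter_ex[B [B0 yB]] : \forall B \near +oo, 0 <= B /\ y <= g B.
      by near=> B; split; near: B; [exact: nbhs_pinfty_ge|exact: ny].
    exact: (nB B).
  have gc' : {within `[0, B], continuous g}.
    by apply: continuous_subspaceW gc => r; rewrite /= !in_itv/= => /andP[->].
  have /(IVT B0 gc')[r] : Num.min (g 0) (g B) <= y <= Num.max (g 0) (g B).
    by rewrite g0 ge_min le_max y0 yB orbT.
  by rewrite in_itv/= => /andP[r0 _] gr; exists r.
have [h hP] := choice surj.
have h_ge0 y : 0 <= y -> 0 <= h y by move=> /hP[].
have ghK y : 0 <= y -> g (h y) = y by move=> /hP[].
have hlt y s : 0 <= y -> 0 <= s -> y < g s -> h y < s.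
  move=> y0 s0 ys; rewrite ltNge; apply/negP => sh.
  by have := classK_le gK s0 sh; rewrite ghK// leNgt ys.
have lth y s : 0 <= y -> 0 <= s -> g s < y -> s < h y.
  move=> y0 s0 ys; rewrite ltNge; apply/negP => sh.
  by have := classK_le gK (h_ge0 _ y0) sh; rewrite ghK// leNgt ys.
have hgK r : 0 <= r -> h (g r) = r.
  move=> r0; have gr0 := classK_ge0 gK r0; apply/eqP; rewrite eq_le.
  rewrite leNgt; apply/andP; split.
    apply/negP => rh; have := glt _ _ r0 rh; by rewrite ghK// ltxx.
  rewrite leNgt; apply/negP => rh; have := glt _ _ (h_ge0 _ gr0) rh.
  by rewrite ghK// ltxx.
exists h; split=> //; split.
- apply/subspace_continuousP => y /=; rewrite in_itv/= andbT => y0.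
  apply/cvgrPdist_lt => e e0.
  have ltge : y < g (h y + e) by rewrite -{1}(ghK _ y0) glt ?h_ge0// ltrDl.
  have near1 : \forall z \near y, z < g (h y + e) by exact: (cvgr_lt y cvg_id).
  (* Monotonicity of [g] is known only on [[0, +oo[]: when [h y - e < 0], the lower estimate follows
     from [h z >= 0] instead. *)
  have near2 : \forall z \near y, h y - e < 0 \/ g (h y - e) < z.
    have [he|he] := ltP (h y - e) 0; first by near=> z; left.
    have : g (h y - e) < y by rewrite -{2}(ghK _ y0) glt// ltrBlDr ltrDl.
    by move=> gy; near=> z; right; near: z; exact: (cvgr_gt y cvg_id).
  suff : \forall z \near y, 0 <= z -> `|h y - h z| < e.
    by apply: filterS => z hz /=; rewrite in_itv/= andbT.
  near=> z => z0.
  rewrite ltr_distlC; apply/andP; split; last first.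
    by apply: hlt => //; [rewrite addr_ge0 ?h_ge0// ltW|near: z].
  have [he|he] := ltP (h y - e) 0; first by rewrite (lt_le_trans he)// h_ge0.
  have [|gz] : h y - e < 0 \/ g (h y - e) < z by near: z.
    by rewrite ltNge he.
  exact: lth.
- by rewrite -[X in h X]g0 hgK.
- by move=> r s r0 rs; apply: hlt; rewrite ?h_ge0 ?ghK// (le_trans r0)// ltW.
Unshelve. all: by end_near. Qed.

(** All class KL bounds below have this form, with [k] equal to [alpha2] and [h] built from the
    inverse of [alpha1]; the exponential comes from the uniform stability of [mu]. *)
Lemma classKL_expR (R : realType) (h k : R -> R) (eps delta : R) :
  classK h -> classK k -> 0 < eps ->
  classKL (fun r t => h (k r * expR (- eps * t + delta))).
Proof.
move=> hK kK eps0; have [_ h0 hlt] := hK; have [_ k0 klt] := kK.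
have ec : continuous (fun t : R => expR (- eps * t + delta)).
  move=> t; apply: (@continuous_comp _ _ _ (fun t => - eps * t + delta) expR).
    by apply: cvgD; [apply: cvgM; [exact: cvg_cst|exact: cvg_id]|exact: cvg_cst].
  exact: continuous_expR.
(* The clamped expression is continuous on the whole plane and agrees with the original one on the
   quadrant. *)
have c2 : continuous (fun p : R * R =>
    h (Num.max 0 (k (Num.max 0 p.1) * expR (- eps * p.2 + delta)))).
  move=> p; apply: (@continuous_comp _ _ _
    (fun p : R * R => k (Num.max 0 p.1) * expR (- eps * p.2 + delta))
    (fun r => h (Num.max 0 r))); last exact: classK_continuous_max0.
  apply: cvgM.
    apply: (@continuous_comp (R * R)%type R R fst (fun r => k (Num.max 0 r)) p).
      exact: cvg_fst.
    exact: classK_continuous_max0.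
  apply: (@continuous_comp (R * R)%type R R snd (fun t => expR (- eps * t + delta)) p).
    exact: cvg_snd.
  exact: ec.
split.
- apply: (@subspace_eq_continuous _ _ _ (fun p : R * R =>
      h (Num.max 0 (k (Num.max 0 p.1) * expR (- eps * p.2 + delta))))); last first.
    exact: continuous_subspaceT.
  move=> p.
  rewrite inE/= => -[p1 p2] /=; rewrite (max_r p1) max_r// mulr_ge0 ?expR_ge0//.
  exact: classK_ge0.
- move=> t t0; split.
  + apply: (@subspace_eq_continuous _ _ _ (fun r : R =>
      h (Num.max 0 (k (Num.max 0 r) * expR (- eps * t + delta))))).
      move=> r; rewrite inE/= in_itv/= andbT => r0.
      rewrite (max_r r0) max_r// mulr_ge0 ?expR_ge0//; exact: classK_ge0.
    apply: continuous_subspaceT => r.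
    apply: (@continuous_comp _ _ _ (fun r : R => k (Num.max 0 r) * expR (- eps * t + delta))
      (fun r => h (Num.max 0 r))); last exact: classK_continuous_max0.
    exact: (cvgM (@classK_continuous_max0 _ _ kK r) (cvg_cst _)).
  + by rewrite k0 mul0r h0.
  + move=> r s r0 rs; apply: hlt; first by rewrite mulr_ge0 ?expR_ge0 ?classK_ge0.
    by rewrite ltr_pM2r ?expR_gt0// klt.
- move=> r t1 t2 r0 t10 t12; apply: classK_le => //.
    by rewrite mulr_ge0 ?expR_ge0 ?classK_ge0.
  by rewrite ler_wpM2l ?classK_ge0// ler_expR lerD2r !mulNr lerN2 ler_pM2l.
- move=> r r0.
  have : h (Num.max 0 (k r * expR (- eps * t + delta))) @[t --> +oo] --> h (Num.max 0 (k r * 0)).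
    apply: (@cvg_comp _ _ _ (fun t => k r * expR (- eps * t + delta)) (fun r => h (Num.max 0 r)));
      last exact: classK_continuous_max0.
    apply: cvgM; first exact: cvg_cst.
    have -> : (fun t => expR (- eps * t + delta)) =
        (fun t => expR delta * expR (- t)) \o (fun t => eps * t).
      by apply/funext => t /=; rewrite addrC expRD mulNr.
    apply: (@cvg_comp _ _ _ (fun t => eps * t) (fun t => expR delta * expR (- t)) _ +oo).
      exact: (gt0_cvgMry eps0 cvg_id).
    have : expR delta * expR (- t) @[t --> +oo] --> expR delta * 0.
      by apply: cvgM; [exact: cvg_cst|exact: cvgr_expR].
    by rewrite mulr0.
  rewrite mulr0 maxxx h0; apply: near_cvg; near=> t.
  by rewrite max_r// mulr_ge0 ?expR_ge0 ?classK_ge0.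
Unshelve. all: by end_near. Qed.

(** * Euclidean norm, history segments and continuity of [V] along a solution *)

(** Passes from the coordinatewise topology to the Euclidean norm through
    [n * (e / n.+1) ^ 2 < e ^ 2]; dividing by [n.+1] also covers [n = 0]. *)
Lemma enorm_lt (R : realType) (n : nat) (y : 'rV[R]_n) (e : R) : 0 < e ->
  (forall i, `|y 0 i| < e / n.+1%:R) -> enorm y < e.
Proof.
move=> e0 ye; rewrite /enorm -[ltRHS](ger0_norm (ltW e0)) -sqrtr_sqr ltr_sqrt ?exprn_gt0//.
apply: (@le_lt_trans _ _ (n%:R * (e / n.+1%:R) ^+ 2)).
  rewrite -[X in X%:R](card_ord n) -sum1_card natr_sum mulr_suml.
  apply: ler_sum => i _; rewrite mul1r -real_normK ?num_real// lerXn2r ?nnegrE// ?ltW//.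
  by rewrite divr_gt0.
rewrite expr_div_n mulrCA gtr_pMr ?exprn_gt0//.
rewrite ltr_pdivrMr ?exprn_gt0// mul1r expr2 -natrM ltr_nat.
by rewrite (leq_trans (ltnSn n))// leq_pmulr.
Qed.

Lemma enorm_ge0 (R : realType) (n : nat) (y : 'rV[R]_n) : 0 <= enorm y.
Proof. exact: sqrtr_ge0. Qed.

Lemma supnorm_ge0 (R : realType) (n : nat) (D : set R) (y : R -> 'rV[R]_n) :
  0 <= supnorm D y.
Proof.
rewrite /supnorm; set A := [set _ | _ in _].
(* By convention [sup] is 0 on a set that is empty or not bounded above. *)
have [supA|nsup] := pselect (has_sup A); last by rewrite sup_out.
have [[r Ar] _] := supA; have [s Ds rE] := Ar.
by apply: le_trans (sup_upper_bound supA Ar); rewrite -rE enorm_ge0.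
Qed.

(** Both points move, as the covering argument for segments requires; in each coordinate both stay
    within half the tolerance of [x r0]. *)
Lemma within_enorm_lt (R : realType) (n : nat) (D : set R) (x : R -> 'rV[R]_n)
    (r0 e : R) : {within D, continuous x} -> D r0 -> 0 < e ->
  exists2 rho, 0 < rho & forall r s, D r -> D s ->
    `|r0 - r| < rho -> `|r0 - s| < rho -> enorm (x r - x s) < e.
Proof.
move=> /subspace_continuousP xc Dr0 e0.
have e'0 : 0 < e / n.+1%:R / 2 by rewrite !divr_gt0.
have : \forall y \near x r0, ball (x r0) (e / n.+1%:R / 2) y by exact: nbhsx_ballx.
move=> /(xc _ Dr0); rewrite /= /within/= => /nbhs_ballP[rho /= rho0 xrho].
exists rho => // r s Dr Ds rr rs; apply: enorm_lt => // i; rewrite !mxE.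
have /= [_ /(_ 0 i) xr] := xrho r rr Dr.
have /= [_ /(_ 0 i) xs] := xrho s rs Ds.
rewrite (splitr (e / _)) -(subrKA (x r0 0 i)) (le_lt_trans (ler_normD _ _))//.
by rewrite ltrD// distrC.
Qed.

Lemma seg_hist (R : realType) (tau : R) (n : nat) (t0 t : R) (T : \bar R)
    (x : R -> 'rV[R]_n) :
  {within [set s : R | t0 - tau <= s /\ (s%:E < T)%E], continuous x} ->
  t0 <= t -> (t%:E < T)%E -> hist tau (seg tau x t).
Proof.
move=> /subspace_continuousP xc t0t tT.
split; last by move=> th; rewrite /seg => /negbTE ->.
apply: (@subspace_eq_continuous _ _ _ (fun th : R => x (t + th))).
  by move=> th; rewrite inE => thI; rewrite /from_subspace /seg ifT.
apply/subspace_continuousP => th thI.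
have D th' : `[- tau, 0]%classic th' -> t0 - tau <= t + th' /\ ((t + th')%:E < T)%E.
  rewrite /= in_itv/= => /andP[th1 th2]; split; first lra.
  by apply: le_lt_trans tT; rewrite lee_fin gerDl.
apply: (@cvg_comp _ _ _ (fun y => t + y) x _ _ _ _ (xc _ (D _ thI))) => P WP.
have tc : (t + y) @[y --> th] --> t + th by apply: cvgD; [exact: cvg_cst|exact: cvg_id].
have : \forall y \near th, t0 - tau <= t + y /\ ((t + y)%:E < T)%E -> P (t + y).
  exact: tc WP.
by apply: filterS => y Py yI; apply: Py; exact: D.
Qed.

(** Continuity of [x] at [t + th] gives an estimate valid near [(t, th)], and compactness of
    [[- tau, 0]] makes the neighbourhood of [t] uniform in [th]. *)
Lemma seg_continuous (R : realType) (tau : R) (n : nat) (t0 t e : R) (T : \bar R)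
    (x : R -> 'rV[R]_n) : 0 <= tau ->
  {within [set s : R | t0 - tau <= s /\ (s%:E < T)%E], continuous x} ->
  t0 <= t -> (t%:E < T)%E -> 0 < e ->
  \forall s \near t, t0 <= s -> (s%:E < T)%E ->
    hnorm tau (seg tau x s \- seg tau x t) < e.
Proof.
move=> tau0 xc t0t tT e0.
have cK : compact (`[- tau, 0]%classic : set R) by exact: segment_compact.
have /compact_near_coveringP cov := cK.
have e20 : 0 < e / 2 by rewrite divr_gt0.
pose D := [set s : R | t0 - tau <= s /\ (s%:E < T)%E].
pose P (s th : R) := D (s + th) -> D (t + th) ->
  enorm (x (s + th) - x (t + th)) < e / 2.
have DI s th : t0 <= s -> (s%:E < T)%E -> th \in `[- tau, 0] -> D (s + th).
  move=> t0s sT; rewrite in_itv/= => /andP[th1 th2]; split; first lra.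
  by apply: le_lt_trans sT; rewrite lee_fin gerDl.
have : \forall s \near t, `[- tau, 0]%classic `<=` P s.
  apply: (cov R (nbhs t) P (nbhs_filter t)) => th thI.
  have [rho rho0 xrho] := within_enorm_lt xc (DI t th t0t tT thI) e20.
  exists (ball th (rho / 2), ball t (rho / 2)) => /=.
    by split; apply: nbhsx_ballx; rewrite divr_gt0.
  move=> [th' s] /= [thth' ts] Ds Dt; apply: xrho => //; move: thth' ts;
    rewrite /ball/= !ltr_norml => /andP[? ?] /andP[? ?]; apply/andP; split; lra.
apply: filterS => s sP t0s sT; rewrite /hnorm /supnorm.
(* A strict bound becomes non-strict under the supremum, hence the tolerance [e / 2]. *)
apply: (@le_lt_trans _ _ (e / 2)); last by rewrite ltr_pdivrMr// ltr_pMr// ltr1n.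
apply: ge_sup.
  exists (enorm ((seg tau x s \- seg tau x t) 0)); exists 0 => //=.
  by rewrite in_itv/= oppr_le0 tau0 lexx.
move=> _ [th thI <-]; rewrite /seg/= (_ : th \in _)//.
by apply: ltW; apply: sP => //; exact: DI.
Qed.

Lemma seg_functional_continuous (R : realType) (tau : R) (n : nat) (t0 b : R)
    (T : \bar R) (x : R -> 'rV[R]_n) (V : R -> (R -> 'rV[R]_n) -> R) :
  0 <= tau -> functional tau V -> 0 <= t0 -> (b%:E < T)%E ->
  {within [set s : R | t0 - tau <= s /\ (s%:E < T)%E], continuous x} ->
  {within `[t0, b], continuous (fun t => V t (seg tau x t))}.
Proof.
move=> tau0 VF t00 bT xc; apply/subspace_continuousP => t /=.
rewrite in_itv/= => /andP[t0t tb].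
have sT s : s <= b -> (s%:E < T)%E by move=> sb; apply: le_lt_trans bT; rewrite lee_fin.
have tauS s : t0 <= s -> - tau <= s by move=> ?; lra.
have [_ VC] := VF _ _ (tauS _ t0t) (seg_hist xc t0t (sT _ tb)).
apply/cvgrPdist_lt => e e0; have [d [d0 Vd]] := VC _ e0.
suff : \forall s \near t, t0 <= s -> s <= b ->
    `|V t (seg tau x t) - V s (seg tau x s)| < e.
  by apply: filterS => s sV /=; rewrite in_itv/= => /andP[]; exact: sV.
have segc := seg_continuous tau0 xc t0t (sT _ tb) d0.
have ballc : \forall s \near t, ball t d s by exact: nbhsx_ballx.
near=> s => t0s sb; rewrite distrC; apply: Vd; first exact: tauS.
- by apply: (seg_hist xc) => //; exact: sT.
- rewrite distrC; have : ball t d s by near: s.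
  by [].
- have : t0 <= s -> (s%:E < T)%E -> hnorm tau (seg tau x s \- seg tau x t) < d by near: s.
  by apply => //; exact: sT.
Unshelve. all: by end_near. Qed.

(** * Primitives of input gains and of [mu] *)

(* Lebesgue differentiation is available for Borel functions only. *)
Lemma borel_representative (R : realType) (f : R -> R) :
  measurable_fun [set: lebesgueType R] (f : lebesgueType R -> R) ->
  exists N : set (measurableTypeR R), [/\ measurable N, lebesgue_measure N = 0%E &
    measurable_fun [set: measurableTypeR R] (f \_ (~` N))].
Proof.
move=> mf.
(* A Lebesgue measurable superlevel set lies between a Borel set [XF.1] and its union with a Borel
   null set [XF.2]. Restricting to rational levels keeps the null sets countable in number. *)
have /choice[XF XFP] (q : rat) : exists XF : set (measurableTypeR R) * set (measurableTypeR R),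
    [/\ measurable XF.1, measurable XF.2, lebesgue_measure XF.2 = 0%E,
        XF.1 `<=` [set x | ratr q < f x] &
        [set x | ratr q < f x] `<=` XF.1 `|` XF.2].
  have : ((@wlength R idfun)^*%mu).-cara.-measurable (f @^-1` `]ratr q, +oo[%classic).
    by rewrite -[X in measurable X]setTI; apply: mf => //; exact: measurable_itv.
  rewrite -completed_caratheodory_measurable g_sigma_completed_algebra_genE.
  move=> [X /= mX [N0 [F [mF F0 NF]] XNE]].
  have {}XNE : X `|` N0 = [set x | ratr q < f x].
    by rewrite XNE; apply/seteqP; split=> x/=; rewrite in_itv/= andbT.
  exists (X, F); split=> //=; rewrite -XNE; first exact: subsetUl.
  exact: setUS.
(* Integers that code no rational are sent to level 0, which adds only a set already in the
   union. *)
pose N := \bigcup_n (XF (odflt 0 (unpickle n))).2.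
have mN : measurable N by apply: bigcupT_measurable => n; case: (XFP (odflt 0 (unpickle n))).
have FN q : (XF q).2 `<=` N by move=> x Fx; exists (pickle q) => //; rewrite pickleK.
exists N; split=> //.
  apply: (measure_negligible mN); apply: negligible_bigcup => n.
  case: (XFP (odflt 0 (unpickle n))) => _ mF F0 _ _.
  exact: (ex_intro _ _ (And3 mF F0 (@subset_refl _ _))).
suff : measurable_fun (~` N : set (measurableTypeR R)) f.
  exact: (measurable_restrictT f (measurableC mN)).1.
suff preN : preimage_set_system (~` N) f (@RGenOInfty.G R) `<=`
    @measurable _ (measurableTypeR R).
  exact: (measurability _ (RGenOInfty.measurableE R) preN).
move=> _ [_ [r ->] <-].
(* Off [N], the set where [f > r] is the union of the Borel approximations over the rational levels
   above [r]. *)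
rewrite (_ : _ `&` _ = \bigcup_(q : rat) if r < ratr q then (XF q).1 `&` ~` N else set0).
  apply: bigcupT_measurable_rat => q; case: ifP => // _; apply: measurableI.
    by case: (XFP q).
  exact: measurableC.
apply/seteqP; split=> x /=.
  rewrite in_itv/= andbT => -[xN] /rat_in_itvoo[q]; rewrite in_itv/= => /andP[rq qf].
  exists q => //; rewrite rq; split=> //.
  by case: (XFP q) => _ _ _ _ /(_ x qf)[//|/FN].
move=> [q _]; case: ifP => // rq [Xx Nx]; split=> //; rewrite in_itv/= andbT.
by case: (XFP q) => _ _ _ /(_ x Xx) qf _; exact: lt_trans rq qf.
Qed.

Lemma derivable_quotient_at_right (R : realType) (F : R -> R) (x : R) :
  derivable F x 1 -> (F (x + d) - F x) / d @[d --> 0^'+] --> derive1 F x.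
Proof.
move=> dF; rewrite derive1E; have /cvg_dnbhs_at_right := dF.
apply: near_cvg; apply: nearW => d /=.
rewrite [d *: 1]mulr1 (addrC d x) [LHS]mulrC. by [].
Qed.

Lemma measurable_classK_enorm (R : realType) (l : nat) (u : R -> 'rV[R]_l) (gam : R -> R) :
  input u -> classK gam ->
  measurable_fun (`[0, +oo[ : set (lebesgueType R))
    (fun t : lebesgueType R => gam (enorm (u t))).
Proof.
move=> [mu_ _] gK.
have -> : (fun t : lebesgueType R => gam (enorm (u t))) =
    (fun r => gam (Num.max 0 (Num.sqrt r))) \o
    (fun t : lebesgueType R => \sum_(i < l) u t 0 i ^+ 2).
  by apply/funext => t /=; rewrite max_r ?sqrtr_ge0.
apply: measurableT_comp.
  apply: continuous_measurable_fun => r.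
  apply: (@continuous_comp _ _ _ Num.sqrt (fun r => gam (Num.max 0 r))).
    exact: sqrt_continuous.
  exact: classK_continuous_max0.
by apply: measurable_sum => i; apply: measurable_funX.
Qed.

(** The integral in [iISS] is taken for the completed measure, differentiation is done for Borel
    functions. Here [Z] is the primitive of a bounded Borel [g] that equals [gam (enorm (u t))]
    almost everywhere on [[0, b]], so it serves both purposes. *)
Lemma input_primitive (R : realType) (l : nat) (u : R -> 'rV[R]_l) (gam : R -> R)
    (t0 b : R) : input u -> classK gam -> 0 <= t0 -> t0 <= b ->
  exists Z : R -> R, [/\ {within `[t0, b], continuous Z}, Z t0 = 0,
    {in `[t0, b] &, {homo Z : s t / s <= t}},
    {ae lebesgue_measure, forall t, t0 < t -> t < b ->
       (Z (t + d) - Z t) / d @[d --> 0^'+] --> gam (enorm (u t))} &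
    Z b = \int[@completed_lebesgue_measure R]_(s in `[t0, b]) gam (enorm (u s))].
Proof.
move=> uI gK t00 t0b; pose f t := gam (enorm (u t)).
have f0 t : 0 <= f t by apply: (classK_ge0 gK); exact: enorm_ge0.
have mE : @measurable _ (lebesgueType R) `[0, b]%classic.
  by apply: sub_caratheodory; exact: measurable_itv.
have mf : measurable_fun [set: lebesgueType R] (f \_ `[0, b] : lebesgueType R -> R).
  apply/(measurable_restrictT _ mE).1.
  apply: measurable_funS (measurable_classK_enorm uI gK).
    by apply: sub_caratheodory; exact: measurable_itv.
  by apply: subset_itvl; rewrite bnd_simp.
have [N1 [mN1 N10 mfN]] := borel_representative mf.
have [_ /(_ b)[M [N2 [mN2 N20 N2M]]]] := uI.
(* [N1] is removed for Borel measurability, [N2] for the essential bound on [u]. *)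
pose N : set (measurableTypeR R) := N1 `|` N2.
have mN : measurable N by exact: measurableU.
have N0 : lebesgue_measure N = 0%E by rewrite -N10; exact: measureU0.
pose g := f \_ (`[0, b] `&` ~` N).
have gE : g = ((f \_ `[0, b]) \_ (~` N1)) \_ (~` N2).
  apply/funext => t; rewrite /g !patchE !in_setI !in_setC !in_setU.
  by case: (t \in `[0, b]%classic); case: (t \in N1); case: (t \in N2).
have mg : measurable_fun [set: measurableTypeR R] g.
  rewrite gE; apply: (measurable_restrictT _ (measurableC mN2)).1.
  exact: measurable_funTS.
have g0 t : 0 <= g t by rewrite /g patchE; case: ifP.
(* The maximum with 0 stays in the range where [gam] is monotone and nonnegative, so it also bounds
   the value 0 that [g] takes elsewhere. *)
have gK' t : g t <= gam (Num.max 0 M).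
  rewrite /g patchE; case: ifPn => [|_]; last first.
    by apply: (classK_ge0 gK); rewrite le_max lexx.
  rewrite inE => -[/=]; rewrite in_itv/= => /andP[t0' tb] Nt.
  apply: (classK_le gK) (enorm_ge0 _) _; rewrite le_max; apply/orP; right.
  apply: contrapT => utM; apply: Nt; right; apply: N2M => /= H; exact/utM/H.
have gout : g = g \_ `[0, b].
  apply/funext => t; rewrite /g !patchE !in_setI.
  by case: (t \in `[0, b]%classic); rewrite ?if_same.
have multy : (lebesgue_measure (`[0%R, b] : set R) < +oo)%E.
  by rewrite lebesgue_measure_itv/=; case: ifP => // _; rewrite -EFinB ltry.
have intT : lebesgue_measure.-integrable [set: measurableTypeR R] (EFin \o g).
  have : lebesgue_measure.-integrable (`[0, b] : set (measurableTypeR R)) (EFin \o g).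
    apply: measurable_bounded_integrable.
    - exact: measurable_itv.
    - exact: multy.
    - exact: measurable_funTS mg.
    - exists (gam (Num.max 0 M)); split; first exact: num_real.
      by move=> r Mr t _; rewrite /= ger0_norm// (le_trans (gK' t))// ltW.
  by rewrite integrable_mkcond; [rewrite restrict_EFin -gout|exact: measurable_itv].
have intE (D : interval R) : lebesgue_measure.-integrable [set` D] (EFin \o g).
  by apply: integrableS intT => //; exact: measurable_itv.
have locg : locally_integrable [set: R] g.
  by apply: open_integrable_locally; [exact: openT|exact: intT].
pose Z t := \int[lebesgue_measure]_(s in `[t0, t]) g s.
exists Z; split.
- exact: parameterized_integral_continuous t0b (intE _).
- by rewrite /Z set_itv1 Rintegral_set1.
- move=> s t _ _ st; rewrite /Z /Rintegral; apply: fine_le.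
  + by apply: integrable_fin_num; [exact: measurable_itv|exact: intE].
  + by apply: integrable_fin_num; [exact: measurable_itv|exact: intE].
  + apply: ge0_subset_integral; [exact: measurable_itv|exact: measurable_itv| | |].
    * by apply/measurable_EFinP; exact: measurable_funTS.
    * by move=> r _; rewrite lee_fin.
    * by apply: subset_itvl; rewrite bnd_simp.
- have aeN : {ae lebesgue_measure, forall t : R, ~ N t}.
    by exists N; split=> // t /= /contrapT.
  have := FTC1 (a := BLeft t0) (fun y => intE _) locg.
  apply: filterS2 aeN; first exact: (ae_filter_ringOfSetsType lebesgue_measure).
  move=> t Nt dZ t0t tb; have [|dZt Zt] := dZ; first by rewrite lte_fin.
  have -> : gam (enorm (u t)) = g t.
    rewrite /g patchE mem_set//; split=> //=.
    by rewrite in_itv/= !ltW// (le_lt_trans t00).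
  by rewrite -Zt; exact: derivable_quotient_at_right.
- rewrite /Z /Rintegral; congr fine.
  (* The identity is measurable from the Lebesgue to the Borel sigma-algebra; integrating [g]
     against the pushforward of the completed measure links the two integrals. *)
  have id_meas : measurable_fun [set: lebesgueType R] (id : lebesgueType R -> measurableTypeR R).
    by move=> _ A mA; rewrite setTI; exact: sub_caratheodory.
  rewrite (_ : integral lebesgue_measure _ _ =
    integral (pushforward (@completed_lebesgue_measure R)
      (id : lebesgueType R -> measurableTypeR R)) `[t0, b] (EFin \o g)).
    have mD : @measurable _ (lebesgueType R) `[t0, b]%classic.
      by apply: sub_caratheodory; exact: measurable_itv.
    rewrite ge0_integral_pushforward//; last 2 first.
    - by apply/measurable_EFinP; exact: measurable_funTS.
    - by move=> r _; rewrite lee_fin.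
    apply: ge0_ae_eq_integral.
    - exact: mD.
    - by apply/measurable_EFinP/measurable_funTS; exact: measurableT_comp mg id_meas.
    - apply/measurable_EFinP; apply: measurable_funS (measurable_classK_enorm uI gK).
        by apply: sub_caratheodory; exact: measurable_itv.
      move=> r /=; rewrite !in_itv/= andbT => /andP[+ _]; exact: le_trans.
    - by move=> r _; rewrite lee_fin.
    - by move=> r _; rewrite lee_fin; exact: f0.
    exists N; split; first exact: sub_caratheodory.
      exact: N0.
    move=> r /= H; apply: contrapT => Nr; apply: H => /=.
    rewrite in_itv/= => /andP[t0r rb].
    rewrite /g patchE mem_set//; split=> //=.
    by rewrite in_itv/= rb (le_trans t00).
  by apply: eq_measure_integral.
Qed.

(** Extending [mu] to the left of 0 by the constant [mu 0] makes it continuous on the line without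
    changing integrals over intervals in [[0, +oo[]. *)
Lemma within_continuous_primitive (R : realType) (mu : R -> R) (a b : R) :
  {within `[0, +oo[, continuous mu} -> 0 <= a -> a <= b ->
  let M t := \int[lebesgue_measure]_(s in `[a, t]) mu s in
  [/\ {within `[a, b], continuous M},
      forall t, a < t -> (M (t + d) - M t) / d @[d --> 0^'+] --> mu t &
      forall t, a <= t -> t <= b ->
        M b - M t = \int[lebesgue_measure]_(s in `[t, b]) mu s].
Proof.
move=> /within_continuous_max0; pose m (r : R) := mu (Num.max 0 r) => mc a0 ab M.
have mi (s t : R) : lebesgue_measure.-integrable `[s, t] (EFin \o m).
  apply: continuous_compact_integrable; first exact: segment_compact.
  exact: continuous_subspaceT.
have mE t : 0 <= t -> m t = mu t by move=> t0; rewrite /m max_r.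
have ME (s t : R) : 0 <= s -> \int[lebesgue_measure]_(r in `[s, t]) mu r =
    \int[lebesgue_measure]_(r in `[s, t]) m r.
  move=> s0; apply: eq_Rintegral => r; rewrite inE/= in_itv/= => /andP[sr _].
  by rewrite mE// (le_trans s0).
have -> : M = fun t => \int[lebesgue_measure]_(s in `[a, t]) m s.
  by apply/funext => t; exact: ME.
split.
- exact: parameterized_integral_continuous ab (mi _ _).
- move=> t at_; have tt : t < t + 1 by rewrite ltrDl.
  have [||dM Mt] := @continuous_FTC1 _ m (BLeft a) _ _ tt (mi _ _).
  + by rewrite lte_fin.
  + exact: mc.
  rewrite -mE; last by rewrite (le_trans a0)// ltW.
  by rewrite -Mt; exact: derivable_quotient_at_right.
- move=> t at_ tb; rewrite ME ?(le_trans a0)//.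
  rewrite Rintegral_itvB//; apply: Rintegral_itv_obnd_cbnd.
  apply: integrableS (mi t b); [exact: measurable_itv|exact: measurable_itv|].
  by apply: subset_itvr; rewrite bnd_simp.
Qed.

(** * Decay under a uniformly stable rate *)

(** For the primitive [M] of [mu], the bound on integrals yields both
    [M b <= - eps * (b - a) + delta] and, after dropping a nonpositive term,
    [M b - M t <= delta]. *)
Lemma usf_comparison (R : realType) (mu v g Z : R -> R) (eps delta a b : R) :
  {within `[0, +oo[, continuous mu} -> 0 < eps ->
  (forall s t : R, 0 <= s -> s <= t ->
     \int[lebesgue_measure]_(r in `[s, t]) mu r <= - eps * (t - s) + delta) ->
  0 <= a -> a <= b ->
  {within `[a, b], continuous v} -> {within `[a, b], continuous Z} ->
  (forall t, a <= t <= b -> 0 <= v t) -> (forall t, 0 <= g t) ->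
  {in `[a, b] &, {homo Z : s t / s <= t}} -> Z a = 0 ->
  {ae lebesgue_measure, forall t, a < t -> t < b ->
     (Z (t + d) - Z t) / d @[d --> 0^'+] --> g t} ->
  (forall t, a < t -> t < b -> (dini v t < +oo)%E) ->
  {ae lebesgue_measure, forall t, a < t -> t < b ->
     (dini v t <= ((g t + mu t) * v t + g t)%:E)%E} ->
  v b <= expR (Z b) * (expR (- eps * (b - a) + delta) * v a + expR delta * Z b).
Proof.
move=> muc eps0 mule a0 ab vc Zc v0 g0 Zmono Za dZ vlty vle.
have [Mc dM MB] := within_continuous_primitive muc a0 ab.
set M := (fun t : R => _) in Mc dM MB.
have Ma : M a = 0 by rewrite /M set_itv1 Rintegral_set1.
have Mdelta t : a <= t <= b -> M b - M t <= delta.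
  move=> /andP[at_ tb]; rewrite MB// (le_trans (mule _ _ (le_trans a0 at_) tb))//.
  by rewrite gerDr mulNr oppr_le0 mulr_ge0 ?subr_ge0// ltW.
have := ae_dini_comparison ab vc Zc Mc v0 g0 Zmono Za Ma Mdelta (fun t at_ _ => dM t at_)
  dZ vlty vle.
move=> /le_trans; apply; rewrite ler_wpM2l ?expR_ge0// lerD2r.
by rewrite ler_wpM2r ?v0 ?lexx// ler_expR mule.
Qed.

(** Let [s] be the last time in [[a, b]] at which [v <= c]. Past [s] the differential inequality is
    in force, whence [v b <= expR delta * c]; if there is no such time, decay starts at [a]. With
    [c = 0] this is pure decay. *)
Lemma usf_decay (R : realType) (mu v : R -> R) (eps delta a b c : R) :
  {within `[0, +oo[, continuous mu} -> 0 < eps -> 0 <= delta ->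
  (forall s t : R, 0 <= s -> s <= t ->
     \int[lebesgue_measure]_(r in `[s, t]) mu r <= - eps * (t - s) + delta) ->
  0 <= a -> a <= b -> 0 <= c ->
  {within `[a, b], continuous v} -> (forall t, a <= t <= b -> 0 <= v t) ->
  (forall t, a <= t -> t <= b -> c <= v t -> (dini v t < +oo)%E) ->
  {ae lebesgue_measure, forall t, a <= t -> t <= b -> c <= v t ->
     (dini v t <= (mu t * v t)%:E)%E} ->
  v b <= expR (- eps * (b - a) + delta) * v a + expR delta * c.
Proof.
move=> muc eps0 delta0 mule a0 ab c0 vc v0 vlty vle.
have decay s : a <= s -> s <= b -> (forall t, s < t -> t < b -> c <= v t) ->
    v b <= expR (- eps * (b - s) + delta) * v s.
  move=> as_ sb cv.
  have vc' : {within `[s, b], continuous v}.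
    by apply: continuous_subspaceW vc; apply: subset_itvr; rewrite bnd_simp.
  have -> : expR (- eps * (b - s) + delta) * v s =
      expR 0 * (expR (- eps * (b - s) + delta) * v s + expR delta * 0).
    by rewrite expR0 mulr0 addr0 mul1r.
  apply: (@usf_comparison R mu v (fun=> 0) (fun=> 0)) => //.
  - exact: le_trans as_.
  - by move=> t; exact: cvg_cst.
  - by move=> t /andP[st tb]; rewrite v0// tb (le_trans as_).
  - apply: aeW => t _ _; apply: near_cvg (cvg_cst 0).
    by apply: nearW => d; rewrite subrr mul0r.
  - move=> t st tb; apply: vlty; [exact/ltW/(le_lt_trans as_)|exact: ltW|exact: cv].
  - apply: filterS vle; first exact: (ae_filter_ringOfSetsType lebesgue_measure).
    move=> t vt st tb; rewrite add0r addr0; apply: vt => //.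
    + exact/ltW/(le_lt_trans as_).
    + exact: ltW.
    + exact: cv.
have dc : c <= expR delta * c.
  by rewrite ler_peMl// -expR0 ler_expR.
have A0 : 0 <= expR (- eps * (b - a) + delta) * v a.
  by rewrite mulr_ge0 ?expR_ge0// v0// lexx.
pose S := [set s | a <= s <= b /\ v s <= c].
have [[s0 Ss0]|S0] := pselect (S !=set0); last first.
  rewrite (le_trans (decay a (lexx _) ab _)) ?lerDl ?mulr_ge0 ?expR_ge0//.
  move=> t at_ tb; rewrite leNgt; apply/negP => vt.
  by apply: S0; exists t; split; [rewrite !ltW|exact: ltW].
have supS : has_sup S by split; [exists s0|exists b => t [/andP[]]].
pose s := sup S.
have sb : s <= b by apply: ge_sup; [exists s0|move=> t [/andP[]]].
have as_ : a <= s.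
  by have [/andP[as0 _] _] := Ss0; apply: (le_trans as0); exact: (sup_upper_bound supS).
have vs : v s <= c.
  rewrite leNgt; apply/negP => cv.
  have /subspace_continuousP/(_ s) := vc.
  rewrite /= in_itv/= as_ sb => /(_ isT)/cvgr_gt /(_ _ cv).
  rewrite /within/= => /nbhs_ballP[r /= r0 rv].
  have [t [tab tS] ts] := sup_adherent r0 supS.
  have tles : t <= s by apply: (sup_upper_bound supS); split.
  have : c < v t.
    apply: rv; last by rewrite in_itv.
    by rewrite /ball/= ger0_norm ?subr_ge0// ltrBlDr -ltrBlDl.
  by rewrite ltNge tS.
apply: (@le_trans _ _ (expR delta * c)); last by rewrite lerDr.
apply: (le_trans (decay s as_ sb _)).
  move=> t st tb; rewrite leNgt; apply/negP => vt.
  have : S t by split; [rewrite !ltW// (le_lt_trans as_)|exact: ltW].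
  by move=> /(sup_upper_bound supS); rewrite leNgt st.
apply: ler_pM => //; rewrite ?expR_ge0// ?v0 ?as_//.
by rewrite ler_expR gerDr mulNr oppr_le0 mulr_ge0 ?subr_ge0// ltW.
Qed.

(** * Separating the effects of initial state and input *)

(** The sum is at most twice the larger term. Applied to the inverse of [alpha1], this splits a
    bound into a decay term and a gain term. *)
Lemma classK_sum_le (R : realType) (h : R -> R) (r s : R) :
  classK h -> 0 <= r -> 0 <= s -> h (r + s) <= h (2 * r) + h (2 * s).
Proof.
move=> hK r0 s0; have [rs|/ltW sr] := leP r s.
  have : 0 <= h (2 * r) by apply: (classK_ge0 hK); lra.
  suff : h (r + s) <= h (2 * s) by lra.
  by apply: (classK_le hK); lra.
have : 0 <= h (2 * s) by apply: (classK_ge0 hK); lra.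
suff : h (r + s) <= h (2 * r) by lra.
by apply: (classK_le hK); lra.
Qed.

Lemma classK_scale (R : realType) (c : R) : 0 < c -> classK (fun r : R => c * r).
Proof.
move=> c0; apply: continuous_classK.
- by move=> r; apply: cvgM; [exact: cvg_cst|exact: cvg_id].
- by rewrite mulr0.
- by move=> r s _ rs; rewrite ltr_pM2l.
Qed.

Lemma classK_add_sqr (R : realType) : classK (fun r : R => r + r ^+ 2).
Proof.
apply: continuous_classK.
- by move=> r; apply: cvgD; [exact: cvg_id|exact: exprn_continuous].
- by rewrite expr0n addr0.
- by move=> r s r0 rs; rewrite ltrD// ltrXn2r// nnegrE// (le_trans r0)// ltW.
Qed.

(** With [z = Z t] and [k = expR delta], this is the input part of the bound on
    [expR z * (a + k * z)] obtained from [expR z * a <= a + a ^+ 2 + (expR z - 1) ^+ 2];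
    [classK_add_sqr] handles the state part. *)
Lemma classK_expR_gain (R : realType) (k : R) : 0 < k ->
  classK (fun z : R => (expR z - 1) ^+ 2 + expR z * (k * z)).
Proof.
move=> k0; apply: continuous_classK.
- move=> z; have ez := @continuous_expR R z; apply: cvgD.
    apply: (@continuous_comp _ _ _ (fun z => expR z - 1) (fun y => y ^+ 2)).
      by apply: cvgB => //; exact: cvg_cst.
    exact: exprn_continuous.
  by apply: cvgM => //; apply: cvgM; [exact: cvg_cst|exact: cvg_id].
- by rewrite expR0 subrr expr0n mulr0 mulr0 addr0.
- move=> r s r0 rs; have s0 : 0 <= s by rewrite (le_trans r0)// ltW.
  rewrite ltrD//.
    by rewrite ltrXn2r ?nnegrE ?subr_ge0 -?expR0 ?ler_expR// ltrD2r ltr_expR.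
  by apply: ltr_pM; rewrite ?expR_ge0 ?ltr_expR ?ltr_pM2l// mulr_ge0// ltW.
Qed.

Lemma classK_add (R : realType) (g h : R -> R) :
  classK g -> classK h -> classK (fun r => g r + h r).
Proof.
move=> [gc g0 glt] [hc h0 hlt]; split.
- by move=> r; apply: cvgD; [exact: gc|exact: hc].
- by rewrite g0 h0 addr0.
- by move=> r s r0 rs; rewrite ltrD ?glt ?hlt.
Qed.

(** The bound [M] makes the supremum a genuine upper bound, since [sup] of an unbounded set is 0. *)
Lemma le_supnorm (R : realType) (n : nat) (a b s M : R) (u : R -> 'rV[R]_n) :
  (forall t, a <= t -> t <= b -> enorm (u t) <= M) -> a <= s -> s <= b ->
  enorm (u s) <= supnorm `[a, b] u.
Proof.
move=> uM as_ sb; apply: sup_upper_bound; last first.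
  by exists s => //; rewrite /= in_itv/= as_.
split; first by exists (enorm (u s)); exists s => //; rewrite /= in_itv/= as_.
exists M => _ [t tI <-]; move: tI; rewrite /= in_itv/= => /andP[at_ tb]; exact: uM.
Qed.

(** For ISS, [P] is the condition in [h2], implied by [v >= c] for a suitable [c]; for GUAS and GUES
    it is always true and [c = 0]. *)
Lemma rate_le_decay (R : realType) (mu v : R -> R) (P : R -> Prop)
    (eps delta t0 b c : R) (T : \bar R) :
  {within `[0, +oo[, continuous mu} -> 0 < eps -> 0 <= delta ->
  (forall s t : R, 0 <= s -> s <= t ->
     \int[lebesgue_measure]_(r in `[s, t]) mu r <= - eps * (t - s) + delta) ->
  0 <= t0 -> t0 <= b -> (b%:E < T)%E -> 0 <= c ->
  {within `[t0, b], continuous v} -> (forall t, t0 <= t <= b -> 0 <= v t) ->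
  rate_le t0 T v P (fun t => mu t * v t) ->
  (forall t, t0 <= t -> t <= b -> c <= v t -> P t) ->
  v b <= expR (- eps * (b - t0) + delta) * v t0 + expR delta * c.
Proof.
move=> muc eps0 delta0 mule t00 t0b bT c0 vc v0 [vlty vle] cP.
have sT s : s <= b -> (s%:E < T)%E by move=> sb; apply: le_lt_trans bT; rewrite lee_fin.
apply: (usf_decay muc eps0 delta0 mule) => //.
  by move=> t t0t tb cv; apply: vlty => //; [exact: sT|exact: cP].
apply: filterS vle; first exact: (ae_filter_ringOfSetsType lebesgue_measure).
by move=> t vt t0t tb cv; apply: vt => //; [exact: sT|exact: cP].
Qed.

(** * Stability of the trivial solution from the functional [V] *)

Theorem theorem6 (R : realType) (tau : R) (n l : nat)
    (f : R -> (R -> 'rV[R]_n) -> 'rV[R]_l -> 'rV[R]_n)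
    (V : R -> (R -> 'rV[R]_n) -> R)
    (mu alpha1 alpha2 varpi varpi1 varpi2 : R -> R) :
  0 <= tau ->
  admissible_rhs tau f ->
  functional tau V ->
  USF mu ->
  classKinf alpha1 -> classKinf alpha2 -> classKinf varpi ->
  classK varpi1 -> classK varpi2 ->
  [/\ h1 tau V alpha1 alpha2 -> h2 tau f V mu varpi -> ISS tau f,
      h1 tau V alpha1 alpha2 -> h3 tau f V mu varpi1 varpi2 -> iISS tau f,
      h1 tau V alpha1 alpha2 -> h4 tau f V mu -> GUAS tau f &
      h1 tau V alpha1 alpha2 -> h4 tau f V mu ->
        power_bounds alpha1 alpha2 -> GUES tau f].
Proof.
move=> tau0 _ VF [muc [eps [delta [eps0 delta0 mule]]]] alpha1K [alpha2K _] [varpiK _] K1 K2.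
have [ainv [ainvK ainvE]] := classKinf_inverse alpha1K.
have ainv2K : classK (ainv \o (fun r => 2 * r)) by apply: classK_comp => //; exact: classK_scale.
have le_ainv (r y : R) : 0 <= r -> alpha1 r <= y -> r <= ainv y.
  by move=> r0 ry; rewrite -{1}(ainvE _ r0) (classK_le ainvK)// (classK_ge0 alpha1K.1).
have bounds (t0 : R) T (x : R -> 'rV[R]_n) : h1 tau V alpha1 alpha2 -> 0 <= t0 ->
    (t0%:E < T)%E ->
    {within [set s : R | t0 - tau <= s /\ (s%:E < T)%E], continuous x} ->
    let v t := V t (seg tau x t) in
    [/\ forall b, (b%:E < T)%E -> {within `[t0, b], continuous v},
        forall t : R, t0 <= t -> (t%:E < T)%E -> 0 <= v t,
        v t0 <= alpha2 (hnorm tau (seg tau x t0)) &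
        forall t : R, t0 <= t -> (t%:E < T)%E -> alpha1 (enorm (x t)) <= v t].
  move=> H1 t00 t0T xc v; split.
  - by move=> b bT; exact: seg_functional_continuous xc.
  - move=> t t0t tT; have [|+ _] := VF t (seg tau x t) _ (seg_hist xc t0t tT); last by [].
    by lra.
  - by have [] := H1 t0 (seg tau x t0) t00 (seg_hist xc (lexx _) t0T).
  - move=> t t0t tT; have [+ _] := H1 t (seg tau x t) (le_trans t00 t0t) (seg_hist xc t0t tT).
    by rewrite {1}/seg in_itv/= oppr_le0 tau0 lexx addr0.
(* Common to GUAS and GUES: the estimate before [alpha1] is inverted. *)
have guas : h1 tau V alpha1 alpha2 -> h4 tau f V mu ->
    forall (t0 : R) T (x : R -> 'rV[R]_n), 0 <= t0 -> solution tau f (fun=> 0) t0 T x ->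
    forall t : R, t0 <= t -> (t%:E < T)%E ->
    alpha1 (enorm (x t)) <=
      alpha2 (hnorm tau (seg tau x t0)) * expR (- eps * (t - t0) + delta).
  move=> H1 H4 t0 T x t00 xsol t t0t tT; have [t0T xc _ _] := xsol.
  have [vc v0 vt0 vx] := bounds t0 T x H1 t00 t0T xc.
  have := rate_le_decay muc eps0 delta0 mule t00 t0t tT (lexx _) (vc _ tT) _
    (H4 t0 T x t00 xsol).
  rewrite mulr0 addr0 => vt; apply: (le_trans (vx _ t0t tT)); apply: le_trans (vt _ _) _.
  - by move=> s /andP[t0s st]; apply: v0 => //; apply: le_lt_trans tT; rewrite lee_fin.
  - by [].
  - by rewrite mulrC ler_wpM2r ?expR_ge0.
split.
- move=> H1 H2.
  (* The factor 2 comes from [classK_sum_le] for [ainv]. *)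
  exists (fun r t => (ainv \o (fun r => 2 * r)) (alpha2 r * expR (- eps * t + delta))).
  exists ((ainv \o (fun r => 2 * r)) \o ((fun r => expR delta * r) \o varpi)); split.
  + exact: classKL_expR.
  + apply: classK_comp => //; apply: classK_comp => //; exact: classK_scale (expR_gt0 _).
  move=> u t0 T x uI [M uM] t00 xsol t t0t tT; have [t0T xc _ _] := xsol.
  have [vc v0 vt0 vx] := bounds t0 T x H1 t00 t0T xc.
  (* By monotonicity of [varpi], being above [c] implies the condition in [h2] at every time in
     [[t0, t]]. *)
  pose c := varpi (supnorm `[t0, t] u).
  have c0 : 0 <= c by apply: (classK_ge0 varpiK); exact: supnorm_ge0.
  have vt : V t (seg tau x t) <=
      expR (- eps * (t - t0) + delta) * V t0 (seg tau x t0) + expR delta * c.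
    apply: (rate_le_decay muc eps0 delta0 mule t00 t0t tT c0 (vc _ tT) _
      (H2 u t0 T x uI t00 xsol)) => s.
      by move=> /andP[t0s st]; apply: v0 => //; apply: le_lt_trans tT; rewrite lee_fin.
    move=> t0s st; apply: le_trans; apply: (classK_le varpiK (enorm_ge0 _)).
    by apply: (le_supnorm (M := M)) => // r t0r _; apply: uM; exact: le_trans t0r.
  have a0 := classK_ge0 alpha2K (supnorm_ge0 `[- tau, 0] (seg tau x t0)).
  apply: le_trans (classK_sum_le ainvK _ _); rewrite ?mulr_ge0 ?expR_ge0//.
  apply: le_ainv (enorm_ge0 _) _; apply: (le_trans (vx _ t0t tT)); apply: (le_trans vt).
  by rewrite lerD2r mulrC ler_wpM2r ?expR_ge0.
(* [gam] dominates both gains, so, as [v >= 0], the bound in [h3] is at most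
   [(gam + mu) * v + gam]. *)
- move=> H1 H3; pose gam r := varpi1 r + varpi2 r.
  have gamK : classK gam by exact: classK_add.
  pose q := ainv \o (fun r => 2 * r).
  (* The polynomial [r + r ^+ 2] is what the product [expR (Z t) * a] leaves on the state side when
     it is separated below. *)
  exists (fun r t => (q \o (fun r => r + r ^+ 2)) (alpha2 r * expR (- eps * t + delta))).
  exists (q \o (fun z => (expR z - 1) ^+ 2 + expR z * (expR delta * z))), gam; split => //.
  + by apply: classKL_expR => //; apply: classK_comp => //; exact: classK_add_sqr.
  + by apply: classK_comp => //; exact: classK_expR_gain (expR_gt0 _).
  move=> u t0 T x uI t00 xsol t t0t tT; have [t0T xc _ _] := xsol.
  have [vc v0 vt0 vx] := bounds t0 T x H1 t00 t0T xc.
  have sT s : s <= t -> (s%:E < T)%E by move=> st; apply: le_lt_trans tT; rewrite lee_fin.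
  have [Z [Zc Z0 Zmono dZ <-]] := input_primitive uI gamK t00 t0t.
  have [vlty vle] := H3 u t0 T x uI t00 xsol.
  have vt : V t (seg tau x t) <= expR (Z t) *
     (expR (- eps * (t - t0) + delta) * V t0 (seg tau x t0) + expR delta * Z t).
    apply: (usf_comparison muc eps0 mule t00 t0t (vc _ tT) Zc _ _ Zmono Z0 dZ).
    + by move=> s /andP[t0s st]; apply: v0 => //; exact: sT.
    + by move=> s; apply: (classK_ge0 gamK); exact: enorm_ge0.
    + by move=> s t0s st; apply: vlty => //; [exact: ltW|apply: sT; exact: ltW].
    + apply: filterS vle; first exact: (ae_filter_ringOfSetsType lebesgue_measure).
      move=> s vs t0s st; apply: (le_trans (vs (ltW t0s) (sT _ (ltW st)) Logic.I)).
      have w1 := classK_ge0 K1 (enorm_ge0 (u s)); have w2 := classK_ge0 K2 (enorm_ge0 (u s)).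
      have vs0 := v0 _ (ltW t0s) (sT _ (ltW st)).
      rewrite lee_fin /gam; have := mulr_ge0 w2 vs0; lra.
  have a0 := classK_ge0 alpha2K (supnorm_ge0 `[- tau, 0] (seg tau x t0)).
  have Zt0 : 0 <= Z t by rewrite -Z0 Zmono// in_itv/= t0t lexx.
  set a := alpha2 _ * _.
  have age0 : 0 <= a by rewrite mulr_ge0 ?expR_ge0.
  have Z0e : 0 <= expR (Z t) * (expR delta * Z t) by rewrite !mulr_ge0 ?expR_ge0.
  apply: le_trans (classK_sum_le ainvK _ _); rewrite ?addr_ge0 ?sqr_ge0//.
  apply: le_ainv (enorm_ge0 _) _; apply: (le_trans (vx _ t0t tT)); apply: (le_trans vt).
  have : expR (Z t) * (expR (- eps * (t - t0) + delta) * V t0 (seg tau x t0)) <= expR (Z t) * a.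
    by rewrite ler_wpM2l ?expR_ge0// mulrC ler_wpM2r ?expR_ge0.
  (* [e^z a - a <= a^2 + (e^z - 1)^2] separates the two contributions *)
  have : expR (Z t) * a <= a + a ^+ 2 + (expR (Z t) - 1) ^+ 2.
    have := sqr_ge0 (a - (expR (Z t) - 1)); have := sqr_ge0 a.
    have := sqr_ge0 (expR (Z t) - 1); nra.
  rewrite mulrDr; lra.
- move=> H1 H4; exists (fun r t => ainv (alpha2 r * expR (- eps * t + delta))); split.
    exact: classKL_expR.
  move=> t0 T x t00 xsol t t0t tT; apply: le_ainv (enorm_ge0 _) _.
  exact: guas xsol _ t0t tT.
- move=> H1 H4 [b0 [b1 [b2 [b00 b10 b20 alphaE]]]].
  (* These constants come from taking the [b0]-th root of [b1 * |x| ^ b0 <= b2 * r ^ b0 * expR (-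
     eps * (t - t0) + delta)], where [r] is the norm of the initial segment. *)
  exists (eps / b0), ((b2 / b1 * expR delta) `^ b0^-1); split.
  + by rewrite divr_gt0.
  + by rewrite powR_gt0// mulr_gt0 ?expR_gt0// divr_gt0.
  move=> t0 T x t00 xsol t t0t tT; have := guas H1 H4 _ _ _ t00 xsol _ t0t tT.
  set r := hnorm _ _; have r0 : 0 <= r by exact: supnorm_ge0.
  have y0 := enorm_ge0 (x t).
  rewrite (alphaE _ y0).1 (alphaE _ r0).2 => xr.
  have {}xr : enorm (x t) `^ b0 <= (b2 / b1 * expR delta) * expR (- eps * (t - t0)) * r `^ b0.
    rewrite -(ler_pM2l b10) (le_trans xr)// expRD.
    by rewrite le_eqVlt; apply/orP; left; apply/eqP; field; rewrite gt_eqF.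
  have k0 : 0 <= b2 / b1 * expR delta by rewrite !mulr_ge0 ?invr_ge0 ?expR_ge0 ?ltW.
  move: k0 xr; set k := b2 / b1 * expR delta => k0 xr.
  have ke0 : 0 <= k * expR (- eps * (t - t0)) by rewrite mulr_ge0 ?expR_ge0.
  have rhs0 := mulr_ge0 ke0 (powR_ge0 r b0).
  have ib0 : 0 <= b0^-1 by rewrite invr_ge0 ltW.
  have := ge0_ler_powR ib0 (_ : _ \is Num.nneg) (_ : _ \is Num.nneg) xr.
  rewrite !nnegrE powR_ge0 rhs0 => /(_ isT isT) /=.
  rewrite (powRM _ ke0 (powR_ge0 _ _)) (powRM _ k0 (expR_ge0 _)).
  rewrite -!powRrM divff ?gt_eqF// !powRr1// -expRM => /le_trans; apply.
  rewrite le_eqVlt; apply/orP; left; apply/eqP; congr (_ * expR _ * _); field.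
  by rewrite gt_eqF.
Qed.
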